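(* Let $\lambda,\sigma,\tau>0$ be real and let $p,q,\eta_1,\eta_2$ be complex with $\Re(p)>0$, $\Re(q)>0$, $\Re(\eta_1)>0$ and $\Re(1-\eta_2)>0$. Then $$B_{p,q}^{\lambda;\sigma,\tau}(\eta_1,1-\eta_2)=\sum_{n=0}^\infty\frac{(\eta_2)_n}{n!}\,B_{p,q}^{\lambda;\sigma,\tau}(\eta_1+n,1).$$
   Context: $E_\lambda(x)=\sum_{n=0}^\infty \frac{x^n}{\Gamma(\lambda n+1)}$ is the Mittag-Leffler function. For real $\lambda,\sigma,\tau>0$ and complex $x,y,p,q$ with $\Re(x)>0$, $\Re(y)>0$, $\Re(p)\ge 0$, $\Re(q)\ge 0$, the extended beta function is $$B_{p,q}^{\lambda;\sigma,\tau}(x,y)=\int_0^1 t^{x-1}(1-t)^{y-1}E_\lambda\!\left(-\frac{p}{t^\sigma}\right)E_\lambda\!\left(-\frac{q}{(1-t)^\tau}\right)dt.$$ $(a)_n=a(a+1)\cdots(a+n-1)$, $(a)_0=1$, is the Pochhammer symbol.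
   Formalization: For λ>1 the integrals defining B at (η₁,1−η₂) and at (η₁+n,1) are assumed to exist, since they can diverge (e.g. λ=3, p>0, where E_λ(−p/t^σ) oscillates with exponential growth as t→0); for 0<λ≤1 nothing is added. *)

(* Defs.v *)
From HB Require Import structures.
From mathcomp Require Export all_boot all_order all_algebra.
From mathcomp Require Export complex.
From mathcomp Require Export all_classical all_reals all_analysis.
Export numFieldNormedType.Exports.
Export Order.TTheory GRing.Theory Num.Theory.

Set Implicit Arguments.
Unset Strict Implicit.
Unset Printing Implicit Defensive.

Local Open Scope classical_set_scope.
Local Open Scope complex_scope.
Local Open Scope ring_scope.

(** Complex-valued Lebesgue integrals over a set of real numbers, by real and
    imaginary parts. [cintegral] is total: it is meaningful under
    [cintegrable]. *)
Definition cintegrable (R : realType) (D : set R) (f : R -> R[i]) : Prop :=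
  (@lebesgue_measure R).-integrable D (fun t => (complex.Re (f t))%:E) /\
  (@lebesgue_measure R).-integrable D (fun t => (complex.Im (f t))%:E).

Definition cintegral (R : realType) (D : set R) (f : R -> R[i]) : R[i] :=
  Rintegral (@lebesgue_measure R) D (fun t => complex.Re (f t)) +i*
  Rintegral (@lebesgue_measure R) D (fun t => complex.Im (f t)).

(** Principal value of [t ^ z] for [0 < t]: [t ^ Re z * exp (i * Im z * ln t)].
    It is only used for such [t]. *)
Definition cpowR (R : realType) (t : R) (z : R[i]) : R[i] :=
  (t `^ complex.Re z)%:C *
  (cos (complex.Im z * ln t) +i* sin (complex.Im z * ln t)).

Definition Gamma (R : realType) (x : R) : R :=
  Rintegral (@lebesgue_measure R) `]0, +oo[ (fun t => t `^ (x - 1) * expR (- t)).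

(** Rising factorial [(a)_n = a (a + 1) ... (a + n - 1)]. *)
Definition pochhammer (R : realType) (a : R[i]) (n : nat) : R[i] :=
  \prod_(k < n) (a + k%:R).

(** The library puts the norm topology on [R[i]^o], not on [R[i]] itself. *)
Definition mittag_leffler (R : realType) (lam : R) (x : R[i]) : R[i] :=
  limn (series (fun n : nat => x ^+ n / (Gamma (lam * n%:R + 1))%:C)
        : nat -> R[i]^o).

Definition extbeta_integrand (R : realType) (lam sig tau : R)
    (p q x y : R[i]) (t : R) : R[i] :=
  cpowR t (x - 1) * cpowR (1 - t) (y - 1) *
  mittag_leffler lam (- (p / (t `^ sig)%:C)) *
  mittag_leffler lam (- (q / ((1 - t) `^ tau)%:C)).

Definition extbeta (R : realType) (lam sig tau : R) (p q x y : R[i]) : R[i] :=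
  cintegral `]0, 1[ (extbeta_integrand lam sig tau p q x y).

(** The integral defining [extbeta] exists. When [Re p], [Re q], [Re x] and
    [Re y] are positive this is automatic for [lam <= 1], because the function
    [mittag_leffler lam] is then bounded on the left half-plane. It can fail for
    every [lam > 1]: [mittag_leffler lam z] grows like [exp (z ^ (1 / lam)) / lam]
    in the sector [|arg z| < lam * pi / 2], which then contains points of the
    open left half-plane, and the integrand oscillates with exponentially
    growing amplitude near [0] or [1]. *)
Definition extbeta_exists (R : realType) (lam sig tau : R)
    (p q x y : R[i]) : Prop :=
  cintegrable `]0, 1[ (extbeta_integrand lam sig tau p q x y).

(* Main.v *)
Require Import Defs.
From mathcomp Require Import ring lra measurable_realfun.

(** Writing [E] for [mittag_leffler lam], the integrand of [B(eta1, 1 - eta2)]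
    is the integrand of [B(eta1, 1)] times [(1 - t) ^ (- eta2)], and
    multiplying the latter integrand by [t ^ n] turns [eta1] into [eta1 + n].
    Since [(1 - t) ^ (- eta2)] is the sum of the binomial series with terms
    [(eta2)_n / n! * t ^ n] on ]0, 1[, the identity is the exchange of this sum
    with the integral.

    The exchange is made by dominated convergence on the partial sums [S_n]
    ([extbeta_binomial_cvg]). The essential bound is
    [|S_n t| <= C * (1 + (1 - t) ^ (- Re eta2))] ([binomial_sum_dominated]): it
    has the exact exponent [- Re eta2], so that the dominating function is a
    multiple of the sum of the moduli of the integrands of [B(eta1, 1)] and
    [B(eta1, 1 - eta2)], and is integrable as soon as these integrals exist.
    This matters for [lam > 1], where existence is the only information on the
    integrands and leaves no room in the exponent. For [Re eta2 > 0] the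
    bound holds because the coefficients are dominated by those of the real
    exponent [Re eta2]. For [Re eta2 <= 0] it comes from Abel summation, as
    the sums of coefficients are the coefficients of [eta2 + 1] and stay
    bounded; absolute values would lose a logarithm when [Re eta2 = 0].

    For [lam <= 1] the integrals exist because [|E (- z)| <= 1] when
    [Re z >= 0] ([normc_mittag_leffler_le1]). The function
    [u s = E (- z s ^ lam)] solves the fractional differential equation
    [D ^ lam u = - z u] with [u 0 = 1]. Its implicit Gruenwald-Letnikov
    discretisation has the explicit solution
    [u_n = \sum_k (- w) ^ k (lam k + 1)_n / n!], where [w = z h ^ lam] for the
    step [h]. The recurrence expresses [(1 + w) u_n] as an average of [1] and
    of [u_0, ..., u_(n - 1)], because the weights [- (- lam)_j / j!] are
    nonnegative for [j >= 1] and [lam <= 1]; as [|1 + w| >= 1], all [|u_n|] are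
    at most [1] ([normc_discrete_ml_le], where the series is cut at a finite
    order and an error term appears). With [h = 1 / n] and [n] going to
    infinity, Euler's limit
    [(a + 1)_n / (n! n ^ a) --> 1 / Gamma (a + 1)] ([gauss_ratio_cvg])
    transforms [u_n] into [E (- z)]. The limit may be taken term by term since
    the sequence in Euler's limit decreases, so that the terms for one [n]
    dominate those for all larger ones. *)

Set Implicit Arguments.
Unset Strict Implicit.
Unset Printing Implicit Defensive.

Local Open Scope classical_set_scope.
Local Open Scope complex_scope.
Local Open Scope ring_scope.

Local Notation normc := ComplexField.Normc.normc.

(** * The coefficients (a)_n / n! *)

(** The binomial coefficient [C(a + n - 1, n)], that is [(a)_n / n!], as a
    product of fractions: successive values then differ by a single factor. *)
Definition rising_coef (F : fieldType) (a : F) (n : nat) : F :=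
  \prod_(k < n) ((a + k%:R) / k.+1%:R).

Section RisingCoef.
Variable F : numFieldType.
Implicit Types a b : F.

Lemma rising_coef0 a : rising_coef a 0 = 1.
Proof. by rewrite /rising_coef big_ord0. Qed.

Lemma rising_coefS a n :
  rising_coef a n.+1 = rising_coef a n * ((a + n%:R) / n.+1%:R).
Proof. by rewrite /rising_coef big_ord_recr. Qed.

Lemma mulr_rising_coefS a n :
  n.+1%:R * rising_coef a n.+1 = (a + n%:R) * rising_coef a n.
Proof.
by rewrite rising_coefS mulrCA mulrC [n.+1%:R * _]mulrC divfK ?pnatr_eq0.
Qed.

Lemma mulr_rising_coef_shift a n :
  a * rising_coef (a + 1) n = n.+1%:R * rising_coef a n.+1.
Proof.
rewrite mulr_rising_coefS; elim: n => [|n IHn].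
  by rewrite !rising_coef0 !mulr1 addr0.
rewrite rising_coefS mulrA IHn rising_coefS -[a + 1 + _]addrA nat1r.
by ring.
Qed.

Lemma rising_coef1 n : rising_coef (1 : F) n = 1.
Proof.
rewrite /rising_coef big1// => k _.
by rewrite -natr1 addrC divff// natr1 pnatr_eq0.
Qed.

(** Chu-Vandermonde. Both sides multiplied by [n + 1] satisfy the same
    recurrence: split [n + 1] as [j + (n + 1 - j)] in the [j]-th term and absorb
    each part into one of the two factors. *)
Lemma rising_coef_convolution a b n :
  \sum_(j < n.+1) rising_coef a j * rising_coef b (n - j)%N
  = rising_coef (a + b) n.
Proof.
elim: n => [|n IHn].
  by rewrite big_ord_recr big_ord0 /= !rising_coef0 add0r mulr1.
have n1_neq0 : n.+1%:R != 0 :> F by rewrite pnatr_eq0.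
apply: (mulfI n1_neq0); rewrite mulr_rising_coefS -IHn mulr_sumr.
rewrite (eq_bigr (fun j : 'I_n.+2 =>
  j%:R * rising_coef a j * rising_coef b (n.+1 - j)%N +
  rising_coef a j * ((n.+1 - j)%:R * rising_coef b (n.+1 - j)%N))); last first.
  move=> j _; have -> : n.+1%:R = j%:R + (n.+1 - j)%:R :> F.
    by rewrite -natrD subnKC// -ltnS.
  by ring.
rewrite big_split /= big_ord_recl /= !mul0r add0r.
rewrite [X in _ + X = _]big_ord_recr /= subnn mul0r mulr0 addr0 -big_split /=.
rewrite mulr_sumr; apply: eq_bigr => -[j /= jn] _.
rewrite /bump /= add1n subSS mulr_rising_coefS subSn// mulr_rising_coefS.
rewrite (_ : n%:R = j%:R + (n - j)%:R); first by ring.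
by rewrite -natrD subnKC.
Qed.

(** The convolution with [b = 1], all of whose coefficients are [1]. *)
Lemma sum_rising_coef a n :
  \sum_(j < n.+1) rising_coef a j = rising_coef (a + 1) n.
Proof.
rewrite -rising_coef_convolution; apply: eq_bigr => j _.
by rewrite rising_coef1 mulr1.
Qed.

(** Both sides are the binomial coefficient [C(m + n, n)]. This exchanges the
    argument, in which a series runs, with the index. *)
Lemma rising_coef_nat m n :
  rising_coef (m.+1%:R : F) n = rising_coef (n.+1%:R : F) m.
Proof.
elim: n m => [|n IHn] m; first by rewrite rising_coef0 rising_coef1.
elim: m => [|m IHm]; first by rewrite rising_coef0 rising_coef1.
rewrite rising_coefS IHn rising_coefS.
rewrite -[RHS](@mulfK _ m.+1%:R) ?pnatr_eq0// [X in _ = X / _]mulrC.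
rewrite mulr_rising_coefS -IHm rising_coefS IHn.
rewrite -!(natr1 n) -!(natr1 m) -(natr1 n.+1) -(natr1 m.+1) -!(natr1 n) -!(natr1 m).
field.
by rewrite !natr1 !pnatr_eq0.
Qed.

Lemma rising_coef_ge0 a n : 0 <= a -> 0 <= rising_coef a n.
Proof.
by move=> a0; apply: prodr_ge0 => k _; rewrite divr_ge0// addr_ge0.
Qed.

Lemma rising_coef_gt0 a n : 0 < a -> 0 < rising_coef a n.
Proof.
by move=> a0; apply: prodr_gt0 => k _; rewrite divr_gt0// ltr_wpDr.
Qed.

Lemma ler_rising_coef a b n : 0 <= a -> a <= b ->
  rising_coef a n <= rising_coef b n.
Proof.
move=> a0 ab; apply: ler_prod => k _.
by rewrite divr_ge0 ?addr_ge0//= ler_wpM2r ?invr_ge0// lerD2r.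
Qed.

End RisingCoef.

Lemma pochhammer_rising_coef (R : realType) (a : R[i]) n :
  pochhammer a n / n`!%:R = rising_coef a n.
Proof.
elim: n => [|n IHn].
  by rewrite /pochhammer rising_coef0 big_ord0 divr1.
rewrite rising_coefS -IHn /pochhammer big_ord_recr /= factS natrM.
by rewrite mulf_div [(n.+1%:R * _)%R]mulrC.
Qed.

(** * Moduli and limits of complex numbers *)

Section ComplexModulus.
Variable R : realType.
Implicit Types z w : R[i].

Lemma normr_normc z : `|z| = (normc z)%:C.
Proof. by case: z => x y; rewrite normc_def. Qed.

Lemma normc_ge0 z : 0 <= normc z.
Proof. by case: z => x y; rewrite sqrtr_ge0. Qed.

Lemma normc_real (x : R) : normc x%:C = `|x|.
Proof. by rewrite /= expr0n addr0 sqrtr_sqr. Qed.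

Lemma normcX z n : normc (z ^+ n) = normc z ^+ n.
Proof.
elim: n => [|n IHn]; first by rewrite !expr0 ComplexField.Normc.normc1.
by rewrite !exprS ComplexField.Normc.normcM IHn.
Qed.

Lemma ler_normc_sum (I : Type) (r : seq I) (P : pred I) (f : I -> R[i]) :
  normc (\sum_(i <- r | P i) f i) <= \sum_(i <- r | P i) normc (f i).
Proof.
elim/big_ind2 : _ => //; first by rewrite ComplexField.Normc.normc0.
by move=> x1 x2 y1 y2 h1 h2; apply: le_trans (le_normcD _ _) _; exact: lerD.
Qed.

Lemma ler_Re_normc z : `|complex.Re z| <= normc z.
Proof.
by case: z => x y /=; rewrite -sqrtr_sqr ler_wsqrtr// lerDl sqr_ge0.
Qed.

Lemma ler_Im_normc z : `|complex.Im z| <= normc z.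
Proof.
by case: z => x y /=; rewrite -sqrtr_sqr ler_wsqrtr// lerDr sqr_ge0.
Qed.

Lemma ler_normc_ReIm z : normc z <= `|complex.Re z| + `|complex.Im z|.
Proof.
case: z => x y /=; rewrite -[leRHS]ger0_norm ?addr_ge0// -sqrtr_sqr ler_wsqrtr//.
rewrite sqrrD !real_normK ?num_real// -addrA [_ *+ 2 + _]addrC addrA lerDl.
by rewrite mulrn_wge0// mulr_ge0.
Qed.

Lemma ReM z w : complex.Re (z * w) =
  complex.Re z * complex.Re w - complex.Im z * complex.Im w.
Proof. by case: z w => [a b] [c d]. Qed.

Lemma ImM z w : complex.Im (z * w) =
  complex.Re z * complex.Im w + complex.Im z * complex.Re w.
Proof. by case: z w => [a b] [c d]. Qed.

Lemma ReD z w : complex.Re (z + w) = complex.Re z + complex.Re w.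
Proof. by case: z w => [a b] [c d]. Qed.

Lemma ImD z w : complex.Im (z + w) = complex.Im z + complex.Im w.
Proof. by case: z w => [a b] [c d]. Qed.

Lemma Re_sum (I : Type) (r : seq I) (P : pred I) (f : I -> R[i]) :
  complex.Re (\sum_(i <- r | P i) f i) = \sum_(i <- r | P i) complex.Re (f i).
Proof. by elim/big_rec2 : _ => // i x y _ <-; rewrite ReD. Qed.

Lemma natr_complex n : n%:R = (n%:R : R)%:C :> R[i].
Proof. by rewrite rmorph_nat. Qed.

Lemma normc_nat n : normc (n%:R : R[i]) = n%:R.
Proof. by rewrite natr_complex normc_real normr_nat. Qed.

Lemma cvg_complex (u : nat -> R[i]) (l : R[i]) :
  (fun n => complex.Re (u n)) @ \oo --> complex.Re l ->
  (fun n => complex.Im (u n)) @ \oo --> complex.Im l ->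
  (u : nat -> R[i]^o) @ \oo --> (l : R[i]^o).
Proof.
move=> /cvgrPdist_lt hr /cvgrPdist_lt hi; apply/cvgrPdist_lt => e e0.
have [e' e'0 ->] : exists2 e', 0 < e' & e = e'%:C.
  move: e0; rewrite ltcE /= => /andP[/eqP ei er]; exists (complex.Re e) => //.
  by case: e ei {er} => x y /= ->.
have e2 : 0 < e' / 2 by rewrite divr_gt0.
near=> n; rewrite normr_normc ltcR.
apply: le_lt_trans (ler_normc_ReIm _) _; rewrite [e']splitr ltrD//.
  suff: `|complex.Re l - complex.Re (u n)| < e' / 2 by case: (l) (u n) => [? ?][].
  by near: n; exact: hr.
suff: `|complex.Im l - complex.Im (u n)| < e' / 2 by case: (l) (u n) => [? ?][].
by near: n; exact: hi.
Unshelve. all: by end_near. Qed.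

Lemma normc_cvg0_ReIm (u : nat -> R[i]) (l : R[i]) :
  (fun n => normc (l - u n)) @ \oo --> (0 : R) ->
  (fun n => complex.Re (u n)) @ \oo --> complex.Re l /\
  (fun n => complex.Im (u n)) @ \oo --> complex.Im l.
Proof.
move=> /cvgrPdist_lt h; split; apply/cvgrPdist_lt => e /h; apply: filterS => n /=.
  rewrite sub0r normrN ger0_norm ?normc_ge0//; apply: le_lt_trans.
  by apply: le_trans (ler_Re_normc _); case: (l) (u n) => [? ?][].
rewrite sub0r normrN ger0_norm ?normc_ge0//; apply: le_lt_trans.
by apply: le_trans (ler_Im_normc _); case: (l) (u n) => [? ?][].
Qed.

End ComplexModulus.

Section CvgComplex.
Variable R : realType.

Lemma limn_complex (u : nat -> R[i]) (l : R[i]) :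
  (fun n => complex.Re (u n)) @ \oo --> complex.Re l ->
  (fun n => complex.Im (u n)) @ \oo --> complex.Im l ->
  limn (u : nat -> R[i]^o) = l.
Proof.
move=> hr hi; apply: cvg_lim; first exact: norm_hausdorff.
exact: cvg_complex.
Qed.

Lemma cvg_normc (u : nat -> R[i]) (l : R[i]) :
  (fun n => complex.Re (u n)) @ \oo --> complex.Re l ->
  (fun n => complex.Im (u n)) @ \oo --> complex.Im l ->
  (fun n => normc (u n)) @ \oo --> normc l.
Proof.
move=> hr hi.
have E (z : R[i]) : normc z = Num.sqrt (complex.Re z ^+ 2 + complex.Im z ^+ 2).
  by case: z.
rewrite E (_ : (fun n => normc (u n)) = Num.sqrt \o (fun n =>
  complex.Re (u n) ^+ 2 + complex.Im (u n) ^+ 2)); last exact/funext.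
apply: continuous_cvg; first exact: sqrt_continuous.
by apply: cvgD; apply: cvgM.
Qed.

End CvgComplex.

(** * Partial sums of the binomial series *)

Definition binomial_sum (F : fieldType) (a : F) (n : nat) (t : F) : F :=
  \sum_(k < n.+1) rising_coef a k * t ^+ k.

Section BinomialSum.
Variable F : numFieldType.
Implicit Types a t : F.

Lemma binomial_sum0 n t : binomial_sum 0 n t = 1 :> F.
Proof.
rewrite /binomial_sum big_ord_recl big1 ?addr0 ?rising_coef0 ?mulr1// => k _.
by rewrite /rising_coef big_ord_recl add0r !mul0r.
Qed.

Lemma binomial_sumS a n t :
  binomial_sum a n.+1 t = binomial_sum a n t + rising_coef a n.+1 * t ^+ n.+1.
Proof. by rewrite /binomial_sum big_ord_recr. Qed.

(** Multiplying the series of [(1 - t) ^ (- a - 1)] by [1 - t] gives the series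
    of [(1 - t) ^ (- a)], up to a boundary term. As the coefficients of [a + 1]
    are the sums of those of [a], this is also summation by parts. *)
Lemma binomial_sum_step a n t : binomial_sum a n t =
  (1 - t) * binomial_sum (a + 1) n t + rising_coef (a + 1) n * t ^+ n.+1.
Proof.
elim: n => [|n IHn].
  rewrite /binomial_sum !big_ord_recr !big_ord0 /= !rising_coef0 expr1 expr0.
  by ring.
rewrite !binomial_sumS IHn.
have -> : rising_coef a n.+1 = rising_coef (a + 1) n.+1 - rising_coef (a + 1) n.
  by rewrite -!sum_rising_coef [\sum_(j < n.+2) _]big_ord_recr /= addrAC subrr add0r.
by rewrite [t ^+ n.+2]exprS; ring.
Qed.

Lemma binomial_sum_geometric n t :
  (1 - t) * \sum_(k < n.+1) t ^+ k + t ^+ n.+1 = 1.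
Proof.
rewrite -[RHS](binomial_sum0 n t) binomial_sum_step add0r rising_coef1 mul1r.
by congr (_ * _ + _); rewrite /binomial_sum; apply: eq_bigr => k _; rewrite rising_coef1 mul1r.
Qed.

(** Induction on [m] through [binomial_sum_step], whose boundary term is
    nonnegative. It controls every series of polynomial times geometric
    growth met below. *)
Lemma binomial_sum_nat_le m n t : 0 <= t -> t < 1 ->
  binomial_sum m%:R n t <= (1 - t) ^- m.
Proof.
move=> t0 t1; have t1' : 0 < 1 - t by rewrite subr_gt0.
elim: m => [|m IHm]; first by rewrite binomial_sum0 expr0 invr1.
rewrite exprS invfM ler_pdivlMl//; apply: le_trans IHm.
rewrite (binomial_sum_step m%:R) natr1 lerDl.
by rewrite mulr_ge0 ?exprn_ge0// rising_coef_ge0.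
Qed.

End BinomialSum.

Section RisingCoefModulus.
Variable R : realType.
Implicit Types (a b t D : R) (z : R[i]).

Lemma nneg_bounded_sum_cvg0 (u : R^nat) (M : R) : (forall n, 0 <= u n) ->
  (forall n, \sum_(k < n.+1) u k <= M) -> u @ \oo --> 0.
Proof.
move=> u0 uM; apply: cvg_series_cvg_0; apply: nondecreasing_is_cvgn.
  by apply/nondecreasing_seqP => n; rewrite /series /= big_nat_recr//= lerDl.
exists M => _ [n _ <-]; rewrite /series /= big_mkord; apply: le_trans (uM n).
by rewrite big_ord_recr /= lerDl.
Qed.

Lemma normc_rising_coef_le z a n : normc z <= a ->
  normc (rising_coef z n) <= rising_coef a n.
Proof.
move=> za; elim: n => [|n IHn].
  by rewrite !rising_coef0 ComplexField.Normc.normc1.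
rewrite !rising_coefS ComplexField.Normc.normcM ler_pM ?normc_ge0//.
rewrite ComplexField.Normc.normcM ComplexField.Normc.normcV normc_nat.
rewrite ler_wpM2r ?invr_ge0//.
by apply: le_trans (le_normcD _ _) _; rewrite normc_nat lerD2r.
Qed.

Lemma rising_coef_geometric_cvg0 m t : 0 <= t -> t < 1 ->
  (fun n => rising_coef (m%:R : R) n * t ^+ n) @ \oo --> 0.
Proof.
move=> t0 t1; apply: (@nneg_bounded_sum_cvg0 _ ((1 - t) ^- m)) => n.
  by rewrite mulr_ge0 ?exprn_ge0// rising_coef_ge0.
exact: binomial_sum_nat_le.
Qed.

(** [1 + y <= exp y], and the sum of the [1 / k ^ 2] is at most [2] by
    comparison with a telescoping sum. *)
Lemma prod_inv_sqr_le D n : 0 <= D ->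
  \prod_(k < n) (1 + D / k.+1%:R ^+ 2) <= expR (2 * D).
Proof.
move=> D0; case: n => [|n]; first by rewrite big_ord0 -expR0 ler_expR mulr_ge0.
(* The exponent is sharpened to make the induction work:
   [1 / (n + 2) ^ 2 <= 1 / (n + 1) - 1 / (n + 2)]. *)
apply: (@le_trans _ _ (expR (D * (2 - n.+1%:R^-1)))); last first.
  by rewrite ler_expR mulrC ler_wpM2r// lerBlDr lerDl.
elim: n => [|n IHn].
  rewrite big_ord_recr big_ord0 /= mul1r invr1 expr1n divr1.
  by rewrite (_ : 2 - 1 = 1 :> R) ?mulr1 ?expR_ge1Dx//; lra.
rewrite big_ord_recr /=.
have -> : D * (2 - n.+2%:R^-1) =
    D * (2 - n.+1%:R^-1) + D / (n.+1%:R * n.+2%:R) :> R.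
  by rewrite -!natr1; field; rewrite !natr1 !pnatr_eq0.
rewrite expRD ler_pM//.
- by apply: prodr_ge0 => k _; rewrite addr_ge0// divr_ge0// exprn_ge0.
- by rewrite addr_ge0// divr_ge0// exprn_ge0.
- apply: le_trans (expR_ge1Dx _); rewrite lerD2l ler_wpM2l//.
  rewrite lef_pV2 ?posrE ?mulr_gt0 ?exprn_gt0// expr2 ler_wpM2r//.
  by rewrite ler_nat.
Qed.

Lemma normc_le_of_sqr z x D : 0 < x -> 0 <= D ->
  complex.Re z ^+ 2 + complex.Im z ^+ 2 <= x ^+ 2 + D ->
  normc z <= x * (1 + D / x ^+ 2).
Proof.
move=> x0 D0; case: z => u v /= h.
have D1 : 0 <= D / x ^+ 2 by rewrite divr_ge0// exprn_ge0// ltW.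
have y0 : 0 <= x * (1 + D / x ^+ 2) by rewrite mulr_ge0 ?addr_ge0// ltW.
rewrite -[leRHS]ger0_norm// -sqrtr_sqr ler_wsqrtr//; apply: le_trans h _.
rewrite exprMn sqrrD expr1n mul1r mulrDr mulrDr mulr1.
have -> : x ^+ 2 * (D / x ^+ 2 *+ 2) = D *+ 2.
  by rewrite -mulrnAl mulrC divfK// sqrf_eq0 gt_eqF.
rewrite -addrA lerD2l mulr2n -addrA lerDl addr_ge0//.
by rewrite mulr_ge0 ?sqr_ge0.
Qed.

(** The ratio of consecutive moduli, [|z + k| / (Re z + k)], differs from [1] by
    [O(1 / k ^ 2)], so that the product of these ratios is bounded. *)
Lemma normc_rising_coef_le_Re z : 0 < complex.Re z ->
  exists C : R, forall n,
    normc (rising_coef z n) <= C * rising_coef (complex.Re z) n.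
Proof.
set a := complex.Re z => a0; set D := complex.Im z ^+ 2.
have D0 : 0 <= D by rewrite sqr_ge0.
have az : 1 <= normc z / a.
  by rewrite ler_pdivlMr// mul1r -(ger0_norm (ltW a0)) ler_Re_normc.
have e1 : 1 <= expR (2 * D) by rewrite -expR0 ler_expR mulr_ge0.
exists (normc z / a * expR (2 * D)) => n.
case: n => [|n].
  rewrite !rising_coef0 ComplexField.Normc.normc1 mulr1.
  by rewrite -[leLHS]mulr1; apply: ler_pM.
apply: (@le_trans _ _ (normc z / a * \prod_(k < n) (1 + D / k.+1%:R ^+ 2) *
    rising_coef a n.+1)); last first.
  rewrite ler_wpM2r ?rising_coef_ge0 ?(ltW a0)//.
  by rewrite ler_wpM2l ?(le_trans ler01)// prod_inv_sqr_le.
elim: n => [|n IHn].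
  rewrite !rising_coefS !rising_coef0 !mul1r !addr0 !divr1 big_ord0 mulr1.
  by rewrite divfK ?gt_eqF.
rewrite rising_coefS ComplexField.Normc.normcM big_ord_recr /=.
rewrite (rising_coefS a n.+1).
rewrite [leRHS](_ : _ = normc z / a * (\prod_(k < n) (1 + D / k.+1%:R ^+ 2)) *
  rising_coef a n.+1 *
  ((a + n.+1%:R) * (1 + D / n.+1%:R ^+ 2) / n.+2%:R)); last by ring.
rewrite ler_pM ?normc_ge0// ComplexField.Normc.normcM.
rewrite ComplexField.Normc.normcV normc_nat.
rewrite ler_wpM2r ?invr_ge0// natr_complex.
have an0 : 0 < a + n.+1%:R by rewrite addr_gt0.
apply: (le_trans (@normc_le_of_sqr _ (a + n.+1%:R) D _ _ _)) => //.
  by rewrite /a /D; case: (z) => u v /=; rewrite addr0.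
rewrite ler_wpM2l ?(ltW an0)// lerD2l ler_wpM2l// lef_pV2 ?posrE ?exprn_gt0//.
by rewrite ler_pXn2r ?nnegrE ?(ltW an0)// lerDr ltW.
Qed.

(** For [Re z <= 0] and [j > 0], [|z + j| ^ 2 <= j ^ 2 + |z| ^ 2], so that the factors
    [|z + j| / j] exceed [1] by at most [|z| ^ 2 / j ^ 2]. *)
Lemma normc_rising_coef_bounded z : complex.Re z <= 0 ->
  exists C : R, forall n, normc (rising_coef (z + 1) n) <= C.
Proof.
move=> a0; set D := complex.Re z ^+ 2 + complex.Im z ^+ 2.
have D0 : 0 <= D by rewrite addr_ge0 ?sqr_ge0.
exists (expR (2 * D)) => n; apply: le_trans (prod_inv_sqr_le n D0).
elim: n => [|n IHn].
  by rewrite rising_coef0 big_ord0 ComplexField.Normc.normc1.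
rewrite rising_coefS big_ord_recr /= ComplexField.Normc.normcM.
rewrite ler_pM ?normc_ge0// ComplexField.Normc.normcM ComplexField.Normc.normcV.
rewrite normc_nat ler_pdivrMr// mulrC.
apply: normc_le_of_sqr => //; rewrite -addrA nat1r natr_complex /D.
case: (z) a0 => u v /= u0; rewrite addr0.
have := mulr_le0_ge0 u0 (ler0n R n.+1); move: (n.+1%:R) => m; nra.
Qed.

End RisingCoefModulus.

Section BinomialSumBound.
Variable R : realType.
Implicit Types (a b t D : R) (z : R[i]).

(** Abel summation: [binomial_sum_step] writes the sum as a combination of the
    coefficients of [z + 1], which are bounded, and the weights of the
    combination are nonnegative of sum [1] by [binomial_sum_geometric]. *)
Lemma normc_binomial_sum_bounded z : complex.Re z <= 0 ->
  exists C : R, forall n t, 0 <= t -> t < 1 ->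
    normc (binomial_sum z n t%:C) <= C.
Proof.
move=> /normc_rising_coef_bounded[C hC]; exists C => n t t0 t1.
have C0 : 0 <= C by apply: le_trans (hC 0%N); exact: normc_ge0.
have t1' : 0 <= 1 - t by rewrite subr_ge0 ltW.
rewrite binomial_sum_step; apply: le_trans (le_normcD _ _) _.
rewrite !ComplexField.Normc.normcM normcX.
have -> : 1 - t%:C = (1 - t)%:C by rewrite rmorphB.
rewrite !normc_real (ger0_norm t0) (ger0_norm t1').
rewrite -[leRHS]mulr1 -[X in _ <= _ * X](binomial_sum_geometric n t) mulrDr lerD//; last first.
  by rewrite ler_wpM2r ?exprn_ge0.
rewrite mulrCA ler_wpM2l// mulr_sumr; apply: le_trans (ler_normc_sum _ _ _) _.
apply: ler_sum => k _; rewrite ComplexField.Normc.normcM normcX normc_real.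
by rewrite ger0_norm// ler_wpM2r ?exprn_ge0.
Qed.

End BinomialSumBound.

(** * The binomial series of a complex power *)

Section ComplexPower.
Variable R : realType.
Implicit Types (t : R) (z w : R[i]).

Lemma cpowR_gt0 t z : 0 < t -> cpowR t z =
  (expR (complex.Re z * ln t))%:C *
  (cos (complex.Im z * ln t) +i* sin (complex.Im z * ln t)).
Proof. by move=> t0; rewrite /cpowR /powR gt_eqF. Qed.

Lemma normc_cpowR t z : normc (cpowR t z) = t `^ complex.Re z.
Proof.
rewrite /cpowR ComplexField.Normc.normcM normc_real ger0_norm ?powR_ge0//.
by rewrite /= cos2Dsin2 sqrtr1 mulr1.
Qed.

Lemma cpowRD t z w : 0 < t -> cpowR t (z + w) = cpowR t z * cpowR t w.
Proof.
move=> t0; rewrite !cpowR_gt0// ReD ImD !mulrDl expRD cosD sinD.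
by apply/eqP; rewrite eq_complex /=; apply/andP; split; apply/eqP; ring.
Qed.

Lemma cpowR_real t (a : R) : cpowR t a%:C = (t `^ a)%:C.
Proof. by rewrite /cpowR /= mul0r cos0 sin0 mulr1. Qed.

Lemma cpowR_nat t n : 0 <= t -> cpowR t n%:R = t%:C ^+ n.
Proof. by move=> t0; rewrite natr_complex cpowR_real powR_mulrn// rmorphXn. Qed.

Lemma cpowR0 t : cpowR t 0 = 1.
Proof. by rewrite -[0]/(0%:C) cpowR_real powRr0. Qed.

End ComplexPower.

Section ComplexDerivative.
Variable R : realType.
Implicit Types (f g : R -> R[i]) (t : R) (z d : R[i]).

(** Stated by the two real derivatives, because the norm of [R[i]] has its values
    in [R[i]] and not in [R]. *)
Definition is_cderive f t d :=
  is_derive t 1 (fun s => complex.Re (f s)) (complex.Re d) /\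
  is_derive t 1 (fun s => complex.Im (f s)) (complex.Im d).

Lemma is_cderiveM f g t df dg : is_cderive f t df -> is_cderive g t dg ->
  is_cderive (fun s => f s * g s) t (df * g t + f t * dg).
Proof.
move=> [f1 f2] [g1 g2]; split.
  rewrite (_ : (fun s => _) = (fun s => complex.Re (f s)) * (fun s => complex.Re (g s))
    - (fun s => complex.Im (f s)) * (fun s => complex.Im (g s))); last first.
    by apply/funext => s; rewrite ReM.
  by apply: is_derive_eq; rewrite ReD !ReM /GRing.scale /=; ring.
rewrite (_ : (fun s => _) = (fun s => complex.Re (f s)) * (fun s => complex.Im (g s))
    + (fun s => complex.Im (f s)) * (fun s => complex.Re (g s))); last first.
  by apply/funext => s; rewrite ImM.
by apply: is_derive_eq; rewrite ImD !ImM /GRing.scale /=; ring.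
Qed.

Lemma is_cderiveD f g t df dg : is_cderive f t df -> is_cderive g t dg ->
  is_cderive (fun s => f s + g s) t (df + dg).
Proof.
move=> [f1 f2] [g1 g2]; split.
  rewrite (_ : (fun s => _) = (fun s => complex.Re (f s)) + (fun s => complex.Re (g s))).
    by apply: is_derive_eq; rewrite ReD.
  by apply/funext => s; rewrite ReD.
rewrite (_ : (fun s => _) = (fun s => complex.Im (f s)) + (fun s => complex.Im (g s))).
  by apply: is_derive_eq; rewrite ImD.
by apply/funext => s; rewrite ImD.
Qed.

Lemma is_cderive_monomial z n t : is_cderive (fun s => z * s%:C ^+ n.+1) t
  (n.+1%:R * z * t%:C ^+ n).
Proof.
rewrite -[t%:C ^+ n]rmorphXn natr_complex /=; split.
  rewrite (_ : (fun s => _) = complex.Re z *: ((id : R -> R) ^+ n.+1)).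
    apply: is_derive_eq; rewrite !(ReM, ImM) /GRing.scale /= -mulr_natl.
    by ring.
  by apply/funext => s; rewrite -rmorphXn ReM/= mulr0 subr0 /GRing.scale /= fctE.
rewrite (_ : (fun s => _) = complex.Im z *: ((id : R -> R) ^+ n.+1)).
  by apply: is_derive_eq; rewrite !(ReM, ImM) /GRing.scale /= -mulr_natl; ring.
by apply/funext => s; rewrite -rmorphXn ImM/= mulr0 add0r /GRing.scale /= fctE.
Qed.

Lemma is_cderive_cpowR_onem z t : t < 1 -> is_cderive (fun s => cpowR (1 - s) z) t
  (- z * cpowR (1 - t) z / (1 - t)%:C).
Proof.
move=> t1; have t1' : 0 < 1 - t by rewrite subr_gt0.
have dl : is_derive t 1 (fun s : R => ln (1 - s)) (- (1 - t)^-1).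
  have d1 := is_derive1_ln t1'.
  have d2 : is_derive t 1 ((cst 1 : R -> R) - id) (- 1).
    by apply: is_derive_eq; rewrite sub0r.
  have := is_derive1_comp (f := @ln R) (g := (cst 1 : R -> R) - id) d1 d2.
  by rewrite mulrN1.
have dc a : is_derive t 1 (fun s : R => a * ln (1 - s)) (- (a / (1 - t))).
  rewrite (_ : (fun s => _) = a *: (fun s : R => ln (1 - s)))//.
  by apply: is_derive_eq; rewrite /GRing.scale /= mulrN.
set a := complex.Re z; set b := complex.Im z.
have de := @is_derive1_comp _ expR (fun s : R => a * ln (1 - s)) _ _ _
  (is_derive_expR _) (dc a).
have dcos := @is_derive1_comp _ (@cos R) (fun s : R => b * ln (1 - s)) _ _ _
  (is_derive_cos _) (dc b).
have dsin := @is_derive1_comp _ (@sin R) (fun s : R => b * ln (1 - s)) _ _ _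
  (is_derive_sin _) (dc b).
have E1 s : s < 1 -> cpowR (1 - s) z = (expR (a * ln (1 - s)) * cos (b * ln (1 - s))) +i*
   (expR (a * ln (1 - s)) * sin (b * ln (1 - s))).
  move=> s1; rewrite cpowR_gt0 ?subr_gt0// -/a -/b.
  by apply/eqP; rewrite eq_complex /= !mul0r subr0 addr0 !eqxx.
have near1 : \forall s \near t, s < 1 by exact: lt_nbhsl.
have RN : complex.Re (- z) = - a by rewrite /a; case: (z).
have IN : complex.Im (- z) = - b by rewrite /b; case: (z).
rewrite /is_cderive E1// -fmorphV; split.
  apply: (@near_eq_is_derive _ _ _ ((expR \o (fun s => a * ln (1 - s))) *
    (cos \o (fun s => b * ln (1 - s))))).
  - by near=> s; rewrite E1//=; near: s.
  - apply: is_derive_eq; rewrite !(ReM, ImM) /GRing.scale /= RN IN.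
    by ring.
apply: (@near_eq_is_derive _ _ _ ((expR \o (fun s => a * ln (1 - s))) *
    (sin \o (fun s => b * ln (1 - s))))).
  - by near=> s; rewrite E1//=; near: s.
  - apply: is_derive_eq; rewrite !(ReM, ImM) /GRing.scale /= RN IN.
    by ring.
Unshelve. all: end_near. Qed.

(** The mean value theorem applied to the real and to the imaginary part, at
    possibly different points: this is the reason for the factor [2]. *)
Lemma mean_value_bound f df a b (M : R) : a <= b ->
  (forall t, a <= t <= b -> is_cderive f t (df t)) ->
  (forall t, a <= t <= b -> normc (df t) <= M) ->
  normc (f b - f a) <= 2 * M * (b - a).
Proof.
move=> ab hd hM; apply: le_trans (ler_normc_ReIm _) _.
rewrite -mulrA mulr_natl mulr2n lerD//.
- have [||c] := @MVT_segment R (fun s => complex.Re (f s))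
    (fun s => complex.Re (df s)) a b ab.
  + by move=> x; rewrite in_itv /= => /andP[/ltW xa /ltW xb]; have [] := hd x; rewrite ?xa.
  + apply: derivable_within_continuous => x; rewrite in_itv /= => /hd[h _].
    exact: ex_derive.
  rewrite in_itv /= => cab h; have -> : complex.Re (f b - f a) =
    complex.Re (f b) - complex.Re (f a) by case: (f b) (f a) => [? ?][].
  rewrite h normrM (ger0_norm (_ : 0 <= b - a)) ?subr_ge0// ler_wpM2r ?subr_ge0//.
  by apply: le_trans (hM _ cab); exact: ler_Re_normc.
- have [||c] := @MVT_segment R (fun s => complex.Im (f s))
    (fun s => complex.Im (df s)) a b ab.
  + by move=> x; rewrite in_itv /= => /andP[/ltW xa /ltW xb]; have [] := hd x; rewrite ?xa.
  + apply: derivable_within_continuous => x; rewrite in_itv /= => /hd[_ h].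
    exact: ex_derive.
  rewrite in_itv /= => cab h; have -> : complex.Im (f b - f a) =
    complex.Im (f b) - complex.Im (f a) by case: (f b) (f a) => [? ?][].
  rewrite h normrM (ger0_norm (_ : 0 <= b - a)) ?subr_ge0// ler_wpM2r ?subr_ge0//.
  by apply: le_trans (hM _ cab); exact: ler_Im_normc.
Qed.

End ComplexDerivative.

Section BinomialSeries.
Variable R : realType.
Implicit Types (t : R) (z : R[i]).

Definition binomial_sum_deriv z n t : R[i] :=
  \sum_(k < n) k.+1%:R * rising_coef z k.+1 * t%:C ^+ k.

Lemma is_cderive_binomial_sum z n t :
  is_cderive (fun s => binomial_sum z n s%:C) t (binomial_sum_deriv z n t).
Proof.
elim: n => [|n IHn].
  rewrite /binomial_sum_deriv big_ord0 (_ : (fun s => _) = fun=> 1).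
    by split; exact: is_derive_cst.
  by apply/funext => s; rewrite /binomial_sum big_ord_recr big_ord0 /= add0r
    rising_coef0 mulr1.
rewrite /binomial_sum_deriv big_ord_recr /=.
rewrite (_ : (fun s => _) = (fun s => binomial_sum z n s%:C +
  rising_coef z n.+1 * s%:C ^+ n.+1)); last first.
  by apply/funext => s; rewrite binomial_sumS.
by apply: is_cderiveD => //; exact: is_cderive_monomial.
Qed.

(** The binomial series solves [(1 - t) y' = z y]; a partial sum does so up to one
    monomial. *)
Lemma binomial_sum_ode z n t :
  (1 - t%:C) * binomial_sum_deriv z n t =
  z * binomial_sum z n t%:C - n.+1%:R * rising_coef z n.+1 * t%:C ^+ n.
Proof.
elim: n => [|n IHn].
  rewrite /binomial_sum_deriv big_ord0 mulr0 /binomial_sum big_ord_recr big_ord0.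
  by rewrite /= mulr_rising_coefS addr0 rising_coef0 add0r !mulr1 subrr.
rewrite /binomial_sum_deriv big_ord_recr /= mulrDr IHn binomial_sumS.
rewrite (mulr_rising_coefS z n.+1) exprS; ring.
Qed.

(** This product tends to [1] with [n]: its value at [0] is [1], and its
    derivative consists of the defect in [binomial_sum_ode] alone. *)
Lemma is_cderive_binomial_remainder z n t : t < 1 ->
  is_cderive (fun s => cpowR (1 - s) z * binomial_sum z n s%:C) t
    (- (n.+1%:R * rising_coef z n.+1 * t%:C ^+ n) * cpowR (1 - t) z / (1 - t)%:C).
Proof.
move=> t1; have t1' : (1 - t)%:C != 0 :> R[i].
  by rewrite fmorph_eq0 gt_eqF// subr_gt0.
have := is_cderiveM (is_cderive_cpowR_onem z t1) (is_cderive_binomial_sum z n t).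
congr is_cderive; apply: (mulIf t1'); rewrite divfK// mulrDl.
rewrite mulrAC divfK// -[_ * _ * (1 - t)%:C]mulrA [_ * (1 - t)%:C]mulrC.
have -> : (1 - t)%:C = 1 - t%:C :> R[i] by rewrite rmorphB.
by rewrite binomial_sum_ode; ring.
Qed.

(** The product [cpowR (1 - s) z * binomial_sum z n s] equals [1] at [s = 0], and
    on [[0, t]] its derivative is [O(n |c_n| t ^ n)] where [c_n] grows
    polynomially, so that at [t] the product differs from [1] by a quantity that
    vanishes with [n]. *)
Lemma binomial_series_cvg z t : 0 <= t -> t < 1 ->
  (fun n => normc (cpowR (1 - t) (- z) - binomial_sum z n t%:C)) @ \oo --> 0.
Proof.
move=> t0 t1; have t1' : 0 < 1 - t by rewrite subr_gt0.
(* An integer bound of [|z|] makes [binomial_sum_nat_le] applicable. *)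
have [m zm] : exists m : nat, normc z <= m%:R.
  exists (Num.truncn (normc z)).+1; rewrite ltW//.
  by rewrite (truncnS_gt (normc z)).
set K := 1 + (1 - t) `^ (complex.Re z - 1).
have hK s : 0 <= s <= t -> (1 - s) `^ (complex.Re z - 1) <= K.
  move=> /andP[s0 st]; have s1 : 0 < 1 - s <= 1.
    by rewrite subr_gt0 (le_lt_trans st)//= lerBlDr lerDl.
  have [e0|e0] := lerP 0 (complex.Re z - 1).
    apply: ler_wpDr; first exact: powR_ge0.
    by rewrite -[leRHS](powRr0 (1 - s)) ger_powR.
  apply: ler_wpDl => //; rewrite -[complex.Re z - 1]opprK !(powRN _ (- _)).
  rewrite lef_pV2 ?posrE ?powR_gt0//; last by case/andP: s1.
  by rewrite ge0_ler_powR ?nnegrE ?oppr_ge0 ?lerD2l ?lerN2 ?(ltW e0)//; lra.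
have bnd n : normc (cpowR (1 - t) (- z) - binomial_sum z n t%:C) <=
  (1 - t) `^ (- complex.Re z) * (2 * K * t) *
    (m%:R * (rising_coef m.+1%:R n * t ^+ n)).
  pose g s := cpowR (1 - s) z * binomial_sum z n s%:C.
  have -> : cpowR (1 - t) (- z) - binomial_sum z n t%:C =
      cpowR (1 - t) (- z) * (1 - g t).
    by rewrite mulrBr mulr1 mulrA -cpowRD// addNr cpowR0 mul1r.
  rewrite ComplexField.Normc.normcM normc_cpowR -normcN opprB.
  have -> : complex.Re (- z) = - complex.Re z by case: (z).
  rewrite -mulrA ler_wpM2l ?powR_ge0//.
  have -> : 1 = g 0.
    rewrite /g subr0 /cpowR powR1 ln1 mulr0 cos0 sin0 !mul1r.
    rewrite /binomial_sum big_ord_recl rising_coef0 expr0 mulr1 big1 ?addr0//.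
    by move=> k _; rewrite expr0n /= mulr0.
  have st1 s : 0 <= s <= t -> 0 < 1 - s.
    by move=> /andP[_ st]; rewrite subr_gt0 (le_lt_trans st).
  have := @mean_value_bound _ g (fun s => - (n.+1%:R * rising_coef z n.+1 *
    s%:C ^+ n) * cpowR (1 - s) z / (1 - s)%:C) 0 t
    (K * (m%:R * (rising_coef m.+1%:R n * t ^+ n))) t0.
  rewrite subr0 => h; apply: le_trans (h _ _) _.
  - by move=> s /st1 s1; apply: is_cderive_binomial_remainder; rewrite -subr_gt0.
  - move=> s st; have s1 := st1 _ st.
    rewrite 2!ComplexField.Normc.normcM normc_cpowR ComplexField.Normc.normcV.
    rewrite normcN !ComplexField.Normc.normcM normc_nat normcX !normc_real.
    rewrite (gtr0_norm s1) (ger0_norm (_ : 0 <= s)); last by case/andP: st.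
    have -> : (1 - s) `^ complex.Re z =
        (1 - s) `^ (complex.Re z - 1) * (1 - s).
      rewrite -[X in _ = _ * X](powRr1 (ltW s1)) -powRD ?subrK//.
      by rewrite (gt_eqF s1) implybT.
    rewrite -[leLHS]mulrA mulfK ?gt_eqF// mulrC ler_pM ?powR_ge0 ?hK//.
      by rewrite !mulr_ge0 ?normc_ge0 ?exprn_ge0//; case/andP: st.
    rewrite mulrA -[m.+1%:R]natr1 mulr_rising_coef_shift ler_pM ?exprn_ge0//.
    + by rewrite mulr_ge0// normc_ge0.
    + by case/andP: st.
    + by rewrite ler_wpM2l// normc_rising_coef_le.
    + by rewrite lerXn2r// ?nnegrE//; case/andP: st.
  - by rewrite le_eqVlt; apply/orP; left; apply/eqP; ring.
have hc : (fun n => (1 - t) `^ (- complex.Re z) * (2 * K * t) *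
    (m%:R * (rising_coef (m.+1%:R : R) n * t ^+ n))) @ \oo --> 0.
  rewrite -[X in _ --> X](mulr0 ((1 - t) `^ (- complex.Re z) * (2 * K * t))).
  apply: cvgMr; rewrite -[X in _ --> X](mulr0 m%:R); apply: cvgMr.
  exact: rising_coef_geometric_cvg0.
apply: (squeeze_cvgr _ (cvg_cst 0) hc).
by near=> n; rewrite normc_ge0 bnd.
Unshelve. all: end_near. Qed.

Lemma binomial_sum_le_powR (a t : R) n : 0 < a -> 0 <= t -> t < 1 ->
  binomial_sum a n t <= (1 - t) `^ (- a).
Proof.
move=> a0 t0 t1; have [h _] := normc_cvg0_ReIm (binomial_series_cvg a%:C t0 t1).
have E k : complex.Re (binomial_sum a%:C k t%:C) = binomial_sum a k t.
  rewrite /binomial_sum Re_sum; apply: eq_bigr => j _.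
  rewrite -rmorphXn (_ : rising_coef a%:C j = (rising_coef a j)%:C).
    by rewrite -rmorphM.
  rewrite /rising_coef rmorph_prod; apply: eq_bigr => i _.
  by rewrite fmorph_div rmorphD !rmorph_nat.
have -> : (1 - t) `^ (- a) = complex.Re (cpowR (1 - t) (- a%:C)).
  by rewrite -rmorphN cpowR_real.
have mono : nondecreasing_seq (fun k => complex.Re (binomial_sum a%:C k t%:C)).
  apply/nondecreasing_seqP => k; rewrite !E binomial_sumS lerDl.
  by rewrite mulr_ge0 ?exprn_ge0// rising_coef_ge0// ltW.
by rewrite -E -(cvg_lim (@Rhausdorff R) h); exact: nondecreasing_cvgn_le (cvgP _ h) n.
Qed.

(** The cases [Re z <= 0] and [0 < Re z] have different reasons: bounded sums of
    coefficients in the first one, coefficients dominated by those of [Re z] in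
    the second one. *)
Lemma binomial_sum_dominated z : exists C : R, forall n t, 0 <= t -> t < 1 ->
  normc (binomial_sum z n t%:C) <= C * (1 + (1 - t) `^ (- complex.Re z)).
Proof.
have [a0|a0] := lerP (complex.Re z) 0.
  have [C hC] := normc_binomial_sum_bounded a0; exists C => n t t0 t1.
  apply: le_trans (hC n t t0 t1) _; rewrite -[leLHS]mulr1 ler_wpM2l ?lerDl ?powR_ge0//.
  by apply: le_trans (hC 0%N 0 _ _); rewrite ?normc_ge0.
have [C hC] := normc_rising_coef_le_Re a0; exists C => n t t0 t1.
have C0 : 0 <= C.
  by apply: le_trans (normc_ge0 _) (le_trans (hC 0%N) _); rewrite rising_coef0 mulr1.
apply: (@le_trans _ _ (C * binomial_sum (complex.Re z) n t)); last first.
  rewrite ler_wpM2l//; apply: ler_wpDl => //; exact: binomial_sum_le_powR.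
rewrite /binomial_sum mulr_sumr; apply: le_trans (ler_normc_sum _ _ _) _.
apply: ler_sum => k _; rewrite ComplexField.Normc.normcM normcX normc_real.
by rewrite ger0_norm// mulrA ler_wpM2r ?exprn_ge0.
Qed.

End BinomialSeries.

(** * Real integrals *)

Section RealIntegrals.
Context d (T : measurableType d) (R : realType) (mu : {measure set T -> \bar R}).
Variables (D : set T) (mD : measurable D).
Implicit Types f g : T -> R.

Lemma Rintegral_dominated_cvg (f_ : nat -> T -> R) f g :
  (forall n, measurable_fun D (f_ n)) ->
  (forall x, D x -> f_ ^~ x @ \oo --> f x) ->
  mu.-integrable D (EFin \o g) ->
  (forall n x, D x -> `|f_ n x| <= g x) ->
  mu.-integrable D (EFin \o f) /\
  (fun n => Rintegral mu D (f_ n)) @ \oo --> Rintegral mu D f.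
Proof.
move=> mf cf ig fg.
have mf' n : measurable_fun D (EFin \o f_ n) by exact/measurable_EFinP.
have cf' x : D x -> (EFin \o f_ ^~ x) @ \oo --> (f x)%:E.
  by move=> Dx; apply: cvg_EFin; [exact: nearW|exact: cf].
have fg' n x : D x -> (`|(EFin \o f_ n) x| <= (EFin \o g) x)%E.
  by move=> Dx; rewrite /= lee_fin fg.
have mf0 : measurable_fun D (EFin \o f) := emeasurable_fun_cvg _ _ mf' cf'.
have [intf _ hcvg] := dominated_convergence mD mf' mf0
  (aeW mu cf') ig (aeW mu (fun x n Dx => fg' n x Dx)).
split => //.
apply: (@fine_cvg _ _ _ _ (fun n => \int[mu]_(x in D) (f_ n x)%:E)%E).
by rewrite fineK//; exact: integrable_fin_num.
Qed.

Lemma integrable_mull (k : R) f :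
  mu.-integrable D (EFin \o f) -> mu.-integrable D (EFin \o (fun x => k * f x)).
Proof. by move=> h; have := integrableZl mD k h. Qed.

Lemma integrable_subr f g : mu.-integrable D (EFin \o f) ->
  mu.-integrable D (EFin \o g) -> mu.-integrable D (EFin \o (fun x => f x - g x)).
Proof. by move=> hf hg; have := integrableB mD hf hg. Qed.

Lemma integrable_addr f g : mu.-integrable D (EFin \o f) ->
  mu.-integrable D (EFin \o g) -> mu.-integrable D (EFin \o (fun x => f x + g x)).
Proof. by move=> hf hg; have := integrableD mD hf hg. Qed.

Lemma integrable_EFin_eq f g : {in D, f =1 g} ->
  mu.-integrable D (EFin \o f) -> mu.-integrable D (EFin \o g).
Proof. by move=> fg; apply: eq_integrable => // x xD; rewrite /= fg. Qed.

Lemma integrable_EFin_le f g : measurable_fun D f ->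
  (forall x, D x -> `|f x| <= g x) ->
  mu.-integrable D (EFin \o g) -> mu.-integrable D (EFin \o f).
Proof.
move=> mf fg; apply: le_integrable => //; first exact/measurable_EFinP.
move=> x Dx; rewrite lee_fin (le_trans (fg x Dx))//; exact: ler_norm.
Qed.

End RealIntegrals.

Section ImproperIntegral.
Variable R : realType.
Notation mu := (@lebesgue_measure R).
Implicit Types (a b l : R) (f F : R -> R).

(** The fundamental theorem of calculus on compact subintervals that increase to
    ]a, b[, and monotone convergence; [f] may be unbounded at both ends. *)
Lemma ge0_integral_oo_primitive f F a b la lb : a < b ->
  (forall x, a < x < b -> 0 <= f x) ->
  (forall x, a < x < b -> {for x, continuous f}) ->
  (forall x, a < x < b -> is_derive x 1 F (f x)) ->
  F x @[x --> a^'+] --> la -> F x @[x --> b^'-] --> lb ->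
  (\int[mu]_(x in `]a, b[) (f x)%:E = (lb - la)%:E)%E.
Proof.
move=> ab f0 cf dF Fa Fb.
have mf : measurable_fun `]a, b[ f.
  apply: open_continuous_measurable_fun => //.
  by move=> x /set_mem /=; rewrite in_itv /=; exact: cf.
(* Divided by at least [3], so that [a + d n < b - d n]. *)
pose d n : R := (b - a) / n.+3%:R.
have d0 n : 0 < d n by rewrite divr_gt0// subr_gt0.
have d3 n : d n <= (b - a) / 3.
  by rewrite ler_wpM2l ?subr_ge0 ?(ltW ab)// lef_pV2 ?posrE// ler_nat.
have dcvg : d @ \oo --> 0.
  rewrite /d -[X in _ --> X](mulr0 (b - a)); apply: cvgMr.
  have := @cvg_harmonic R; rewrite -(cvg_shiftn 2) /=.
  apply: cvg_trans; apply: near_eq_cvg; apply: nearW => n.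
  by rewrite /harmonic /= addn2.
pose G n := `[a + d n, b - d n]%classic.
have G_ab : \bigcup_n G n = `]a, b[%classic.
  apply/seteqP; split => [x [n _]|x] /=; rewrite /G /= !in_itv /=.
    by move=> /andP[h1 h2]; have := d0 n; lra.
  move=> /andP[ax xb].
  have [N _ hN] : \forall n \near \oo, d n < Num.min (x - a) (b - x).
    by apply: (cvgr_lt _ dcvg); rewrite lt_min !subr_gt0 ax xb.
  exists N => //; rewrite /G /= in_itv /=; have := hN N (leqnn N).
  by rewrite /= lt_min => /andP[h1 h2]; lra.
have sG n x : x \in `[a + d n, b - d n] -> a < x < b.
  by rewrite in_itv /= => /andP[h1 h2]; have := d0 n; lra.
have intG n : (\int[mu]_(x in G n) (f x)%:E = (F (b - d n))%:E - (F (a + d n))%:E)%E.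
  apply: continuous_FTC2.
  - by have := d3 n; have := d0 n; lra.
  - by apply: continuous_in_subspaceT => x /set_mem /sG; exact: cf.
  - have cF x : x \in `[a + d n, b - d n] -> {for x, continuous F}.
      move=> /sG /dF h; apply/differentiable_continuous; rewrite -derivable1_diffP.
      exact: ex_derive.
    have le_d : a + d n <= b - d n by have := d3 n; have := d0 n; lra.
    split.
    + move=> x xG; have /sG/dF h : x \in `[a + d n, b - d n] by exact: subset_itv_oo_cc xG.
      exact: ex_derive.
    + by apply: cvg_at_right_filter; apply: cF; rewrite in_itv /= lexx.
    + by apply: cvg_at_left_filter; apply: cF; rewrite in_itv /= lexx andbT.
  - move=> x xG; rewrite derive1E.
    have /sG/dF h : x \in `[a + d n, b - d n] by exact: subset_itv_oo_cc xG.
    by rewrite derive_val.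
have cvgG : (\int[mu]_(x in G n) (f x)%:E @[n --> \oo] --> (lb - la)%:E)%E.
  under eq_fun do rewrite intG; apply: cvg_EFin; first by near=> n.
  apply: cvgB.
    move/cvg_at_leftP : Fb; apply; split.
      by move=> n; have := d0 n; lra.
    by rewrite -[X in _ --> X](subr0 b); apply: cvgB => //; exact: cvg_cst.
  move/cvg_at_rightP : Fa; apply; split.
    by move=> n; have := d0 n; lra.
  by rewrite -[X in _ --> X](addr0 a); apply: cvgD => //; exact: cvg_cst.
have nG : nondecreasing_seq G.
  apply/nondecreasing_seqP => n; rewrite subsetEset /G => x /=.
  have : d n.+1 <= d n.
    by rewrite ler_wpM2l ?subr_ge0 ?(ltW ab)// lef_pV2 ?posrE// ler_nat.
  by rewrite !in_itv /= => h /andP[h1 h2]; apply/andP; split; lra.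
have subG n : G n `<=` `]a, b[.
  by move=> x /= /sG; rewrite in_itv.
have := @ge0_nondecreasing_set_cvg_integral _ (measurableTypeR R) R G (EFin \o f) mu nG.
rewrite G_ab => h; apply: (cvg_unique _ _ cvgG); first exact: ereal_hausdorff.
apply: h => //.
- by move=> n; exact: measurable_itv.
- move=> n; apply/measurable_EFinP; apply: measurable_funS mf => //.
- by move=> n x /= /sG xab; rewrite lee_fin f0.
Unshelve. all: end_near. Qed.

Lemma integrable_EFin_of_ge0_integral f (D : set R) l : measurable D ->
  measurable_fun D f -> (forall x, D x -> 0 <= f x) ->
  (\int[mu]_(x in D) (f x)%:E = l%:E)%E -> mu.-integrable D (EFin \o f).
Proof.
move=> mD mf f0 h; apply/integrableP; split; first exact/measurable_EFinP.
rewrite (_ : (\int[mu]_(x in D) _ = \int[mu]_(x in D) (f x)%:E)%E).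
  by rewrite h ltry.
by apply: eq_integral => x /set_mem Dx; rewrite /= ger0_norm// f0.
Qed.

Lemma continuous_powR_gt0 (c x : R) : 0 < x -> {for x, continuous (@powR R ^~ c)}.
Proof.
move=> x0; apply/differentiable_continuous; rewrite -derivable1_diffP.
by apply: derivable_powR; rewrite in_itv /= x0.
Qed.

Lemma integral_powR (c b : R) : -1 < c -> 0 < b ->
  (\int[mu]_(x in `]0%R, b[) (x `^ c)%:E = (b `^ (c + 1) / (c + 1))%:E)%E.
Proof.
move=> c1 b0; have c10 : 0 < c + 1 by lra.
rewrite -[X in X%:E]subr0.
apply: (@ge0_integral_oo_primitive _ (fun x => x `^ (c + 1) / (c + 1))) => //.
- by move=> x _; exact: powR_ge0.
- by move=> x /andP[x0 _]; exact: continuous_powR_gt0.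
- move=> x /andP[x0 _]; have h := is_derive1_powR (c + 1) x0.
  rewrite (_ : (fun x => _) = (c + 1)^-1 *: (@powR R ^~ (c + 1))); last first.
    by apply/funext => y; rewrite mulrC.
  apply: is_derive_eq; rewrite /GRing.scale /= addrK mulrA mulVf ?mul1r//.
  by rewrite gt_eqF.
- rewrite -[X in _ --> X](mul0r (c + 1)^-1); apply: cvgMl; exact: powR_cvg0.
- apply: cvg_at_left_filter; apply: cvgMl; exact: continuous_powR_gt0.
Qed.

Lemma integrable_powR (c b : R) : -1 < c -> 0 < b ->
  mu.-integrable `]0, b[ (fun x => (x `^ c)%:E).
Proof.
move=> c1 b0.
apply: (integrable_EFin_of_ge0_integral (f := @powR R ^~ c) _ _ _ (integral_powR c1 b0)) => //.
- by apply: measurable_funTS; exact: measurable_powR.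
- by move=> x _; exact: powR_ge0.
Qed.

Lemma integrable_onem_powR (c : R) : -1 < c ->
  mu.-integrable `]0, 1[ (fun x => ((1 - x) `^ c)%:E).
Proof.
move=> c1; have c10 : 0 < c + 1 by lra.
have h : (\int[mu]_(x in `]0%R, 1%R[) ((1 - x) `^ c)%:E = (0 - - (c + 1)^-1)%:E)%E.
  apply: (@ge0_integral_oo_primitive (fun x : R => (1 - x) `^ c)
    (fun x => - ((1 - x) `^ (c + 1) / (c + 1)))) => //.
  - by move=> x _; exact: powR_ge0.
  - move=> x /andP[_ x1].
    apply: (@continuous_comp _ _ _ (fun x : R => 1 - x) (@powR R ^~ c)).
      by apply: cvgB; [exact: cvg_cst|exact: cvg_id].
    by apply: continuous_powR_gt0; rewrite subr_gt0.
  - move=> x /andP[_ x1]; have x1' : 0 < 1 - x by rewrite subr_gt0.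
    have h1 := is_derive1_powR (c + 1) x1'.
    have h2 : is_derive x 1 ((cst 1 : R -> R) - id) (-1).
      by apply: is_derive_eq; rewrite sub0r.
    have h3 := @is_derive1_comp _ (@powR R ^~ (c + 1)) ((cst 1 : R -> R) - id) _ _ _ h1 h2.
    rewrite (_ : (fun x => _) = (- (c + 1)^-1) *:
        (@powR R ^~ (c + 1) \o ((cst 1 : R -> R) - id))); last first.
      apply/funext => y; rewrite -[RHS]/(- (c + 1)^-1 * (1 - y) `^ (c + 1)).
      by rewrite mulNr mulrC.
    apply: is_derive_eq; rewrite /GRing.scale /= addrK mulrN1 mulrNN mulrA mulVf ?mul1r//.
    by rewrite gt_eqF.
  - apply: cvg_at_right_filter; apply: cvgN; rewrite -[X in _ --> X]mul1r; apply: cvgMl.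
    have : (1 - x) `^ (c + 1) @[x --> (0 : R)] --> (1 - 0) `^ (c + 1).
      apply: (@continuous_comp _ _ _ (fun x : R => 1 - x) (@powR R ^~ (c + 1))).
        by apply: cvgB; [exact: cvg_cst|exact: cvg_id].
      by apply: continuous_powR_gt0; rewrite subr0.
    by rewrite subr0 powR1.
  - rewrite -[X in _ --> X]oppr0; apply: cvgN.
    rewrite -[X in _ --> X](mul0r (c + 1)^-1); apply: cvgMl.
    apply/cvg_at_leftP => u [u1 uc].
    move/cvg_at_rightP : (powR_cvg0 c10); apply; split.
      by move=> n; rewrite subr_gt0.
    by rewrite -[X in _ --> X](subrr 1); apply: cvgB => //; exact: cvg_cst.
apply: (integrable_EFin_of_ge0_integral (f := fun x => (1 - x) `^ c) _ _ _ h) => //.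
- apply: measurable_funTS; apply: (measurableT_comp (measurable_powR c)).
  by apply: measurable_funB.
- by move=> x _; exact: powR_ge0.
Qed.

End ImproperIntegral.

(** * Euler's limit for the Gamma function *)

Section GammaLimit.
Variable R : realType.
Notation mu := (@lebesgue_measure R).
Implicit Types (a t x : R).

Lemma bernoulli_ineq (x : R) n : 0 <= x <= 1 -> 1 - n%:R * x <= (1 - x) ^+ n.
Proof.
move=> /andP[x0 x1]; elim: n => [|n IHn]; first by rewrite mul0r subr0 expr0.
rewrite exprS; apply: (@le_trans _ _ ((1 - x) * (1 - n%:R * x))).
  rewrite -natr1; have : 0 <= n%:R * x * x :> R by rewrite !mulr_ge0.
  by move: (n%:R) => m; nra.
by rewrite ler_wpM2l// subr_ge0.
Qed.

Lemma onem_div_le_expR x n : (0 < n)%N -> 0 <= x <= n%:R ->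
  (1 - x / n%:R) ^+ n <= expR (- x).
Proof.
move=> n0 /andP[x0 xn]; have n0' : 0 < n%:R :> R by rewrite ltr0n.
rewrite (_ : expR (- x) = expR (- (x / n%:R)) ^+ n); last first.
  by rewrite -expRM_natr mulNr divfK// gt_eqF.
rewrite lerXn2r ?nnegrE ?expR_ge0//.
  by rewrite subr_ge0 ler_pdivrMr// mul1r.
by rewrite -[_ / _]opprK opprK expR_ge1Dx.
Qed.

(** From [1 - y = (1 - y ^ 2) / (1 + y) >= (1 - y ^ 2) exp (- y)] at [y = x / n], and
    Bernoulli's inequality for the power [n] of the first factor. *)
Lemma onem_div_ge_expR x n : (0 < n)%N -> 0 <= x <= n%:R ->
  expR (- x) * (1 - x ^+ 2 / n%:R) <= (1 - x / n%:R) ^+ n.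
Proof.
move=> n0 /andP[x0 xn]; have n0' : 0 < n%:R :> R by rewrite ltr0n.
set y := x / n%:R.
have y0 : 0 <= y by rewrite divr_ge0.
have y1 : y <= 1 by rewrite ler_pdivrMr// mul1r.
have y2 : 0 <= y ^+ 2 <= 1 by rewrite sqr_ge0 expr_le1.
have -> : x ^+ 2 / n%:R = n%:R * y ^+ 2.
  by rewrite /y; field; rewrite gt_eqF.
apply: (@le_trans _ _ (expR (- x) * (1 - y ^+ 2) ^+ n)).
  by rewrite ler_wpM2l ?expR_ge0// bernoulli_ineq.
rewrite (_ : expR (- x) = expR (- y) ^+ n); last first.
  by rewrite -expRM_natr mulNr /y divfK// gt_eqF.
rewrite -exprMn lerXn2r ?nnegrE ?subr_ge0//.
  by rewrite mulr_ge0 ?expR_ge0// subr_ge0; case/andP: y2.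
rewrite expRN ler_pdivrMl ?expR_gt0//.
have -> : 1 - y ^+ 2 = (1 + y) * (1 - y) by ring.
by rewrite ler_wpM2r ?subr_ge0// expR_ge1Dx.
Qed.

(** Euler's truncated integrand of [Gamma (a + 1)]; the maximum with [0] cuts it
    off at [t = n] and makes it measurable without case analysis. *)
Definition gamma_trunc a n t : R := t `^ a * (Num.max 0 (1 - t / n%:R)) ^+ n.

Lemma gamma_trunc_cvg a t : 0 < t ->
  (fun n => gamma_trunc a n.+1 t) @ \oo --> t `^ a * expR (- t).
Proof.
move=> t0; rewrite /gamma_trunc; apply: cvgMr.
have hl : (fun n => expR (- t) * (1 - t ^+ 2 / n.+1%:R)) @ \oo --> expR (- t).
  rewrite -[X in _ --> X]mulr1; apply: cvgMr; rewrite -[X in _ --> X]subr0.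
  apply: cvgB; first exact: cvg_cst.
  rewrite -[X in _ --> X](mulr0 (t ^+ 2)); apply: cvgMr.
  exact: cvg_harmonic.
apply: (squeeze_cvgr _ hl (cvg_cst (expR (- t)))).
near=> n.
have tn : 0 <= t <= n.+1%:R.
  rewrite ltW//=; apply/ltW.
  near: n; exists (Num.truncn t) => // n /= hn.
  by apply: lt_le_trans (truncnS_gt t) _; rewrite ler_nat ltnS.
have -> : Num.max 0 (1 - t / n.+1%:R) = 1 - t / n.+1%:R.
  by apply/max_idPr; rewrite subr_ge0 ler_pdivrMr// mul1r; case/andP: tn.
by rewrite onem_div_ge_expR// onem_div_le_expR.
Unshelve. all: end_near. Qed.

Lemma gamma_trunc_ge0 a n t : 0 <= gamma_trunc a n t.
Proof. by rewrite mulr_ge0 ?powR_ge0// exprn_ge0// le_max lexx. Qed.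

Lemma gamma_trunc_le a n t : 0 < t -> gamma_trunc a n.+1 t <= t `^ a * expR (- t).
Proof.
move=> t0; rewrite ler_wpM2l ?powR_ge0//.
have [tn|tn] := lerP t n.+1%:R.
  rewrite (_ : Num.max 0 _ = 1 - t / n.+1%:R); first by rewrite onem_div_le_expR// ltW.
  by apply/max_idPr; rewrite subr_ge0 ler_pdivrMr// mul1r.
rewrite (_ : Num.max 0 _ = 0); first by rewrite expr0n expR_ge0.
by apply/max_idPl; rewrite subr_le0 ler_pdivlMr// mul1r ltW.
Qed.

Lemma measurable_gamma_trunc a n : measurable_fun setT (gamma_trunc a n).
Proof.
apply: measurable_funM; first exact: measurable_powR.
apply: measurable_funX; apply: measurable_maxr => //.
by apply: measurable_funB => //; apply: measurable_funM.
Qed.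

(** For [c = 2 (a + 1)], [t <= c exp (t / c)] gives [t ^ a <= c ^ a exp (t / 2)], and
    the exponential that is left is a multiple of a probability density. *)
Lemma integrable_powR_expRN a : 0 <= a ->
  mu.-integrable `]0, +oo[ (EFin \o (fun t => t `^ a * expR (- t))).
Proof.
move=> a0; pose c := 2 * (a + 1); have c0 : 0 < c by rewrite /c; lra.
have h2 : (0 : R) < 2^-1 by rewrite invr_gt0.
have ie := @integrable_exponential_pdf R _ h2.
have ie' : mu.-integrable `]0, +oo[
    (EFin \o (fun t => c `^ a * 2 * exponential_pdf 2^-1 t)).
  by apply: integrable_mull => //; apply: integrableS ie.
apply: le_integrable ie' => //.
  apply/measurable_EFinP; apply: measurable_funTS; apply: measurable_funM.
    exact: measurable_powR.
  by apply: measurableT_comp.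
move=> t; rewrite /= in_itv /= andbT => t0; rewrite lee_fin.
rewrite !ger0_norm ?mulr_ge0 ?powR_ge0 ?expR_ge0 ?exponential_pdf_ge0//.
rewrite exponential_pdfE ?(ltW t0)//.
rewrite [leRHS](_ : _ = c `^ a * expR (- 2^-1 * t)); last by field.
have tc : t `^ a <= c `^ a * expR (t / 2).
  apply: (@le_trans _ _ ((c * expR (t / c)) `^ a)).
    apply: ge0_ler_powR => //; first by rewrite nnegrE ltW.
      by rewrite nnegrE mulr_ge0 ?expR_ge0// ltW.
    rewrite mulrC -ler_pdivrMr//; apply: le_trans (expR_ge1Dx _); lra.
  rewrite powRM ?expR_ge0 ?(ltW c0)// ler_wpM2l ?powR_ge0// -expRM ler_expR.
  rewrite -mulrA ler_wpM2l ?(ltW t0)// mulrC ler_pdivrMr// /c; lra.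
apply: le_trans (ler_wpM2r (expR_ge0 _) tc) _.
rewrite -mulrA -expRD ler_wpM2l ?powR_ge0// ler_expR; lra.
Qed.

Lemma Rintegral_gamma_trunc_cvg a : 0 <= a ->
  (fun n => Rintegral mu `]0, +oo[ (gamma_trunc a n.+1)) @ \oo --> Gamma (a + 1).
Proof.
move=> a0; rewrite /Gamma addrK.
apply: (Rintegral_dominated_cvg _ _ _ (integrable_powR_expRN a0) _).2.
- exact: measurable_itv.
- by move=> n; apply: measurable_funTS; exact: measurable_gamma_trunc.
- by move=> t; rewrite /= in_itv /= andbT; exact: gamma_trunc_cvg.
- move=> n t; rewrite /= in_itv /= andbT => t0.
  by rewrite ger0_norm ?gamma_trunc_ge0// gamma_trunc_le.
Qed.

(** Induction on [m], simultaneously for all [a]: a further factor [1 - t / N]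
    makes the integral a difference of two integrals with exponents [a] and
    [a + 1]. *)
Lemma euler_integral (N : R) m a : 0 <= a -> 0 < N ->
  mu.-integrable `]0, N[ (EFin \o (fun t => t `^ a * (1 - t / N) ^+ m)) /\
  Rintegral mu `]0, N[ (fun t => t `^ a * (1 - t / N) ^+ m) =
    N `^ (a + 1) / (rising_coef (a + 1) m * (a + 1 + m%:R)).
Proof.
move=> a0 N0; elim: m a a0 => [|m IHm] a a0.
  have a1 : -1 < a by lra.
  have E : (fun t : R => t `^ a * (1 - t / N) ^+ 0) = fun t => t `^ a.
    by apply/funext => t; rewrite expr0 mulr1.
  rewrite E; split; first exact: integrable_powR.
  by rewrite /Rintegral integral_powR//= rising_coef0 mul1r addr0.
have [i1 e1] := IHm a a0; have [i2 e2] := IHm (a + 1) (addr_ge0 a0 ler01).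
have i2' : mu.-integrable `]0, N[ (EFin \o (fun t => N^-1 * (t `^ (a + 1) * (1 - t / N) ^+ m))).
  exact: integrable_mull.
have E : {in `]0, N[%classic, (fun t : R => t `^ a * (1 - t / N) ^+ m -
    N^-1 * (t `^ (a + 1) * (1 - t / N) ^+ m)) =1
    (fun t => t `^ a * (1 - t / N) ^+ m.+1)}.
  move=> t /set_mem /=; rewrite in_itv /= => /andP[t0 _].
  rewrite powRD ?(gt_eqF t0) ?implybT// powRr1 ?(ltW t0)// exprS; ring.
split.
  have h := integrable_subr _ i1 i2'.
  by apply: (integrable_EFin_eq _ _ (h _)).
transitivity (Rintegral mu `]0, N[ (fun t => t `^ a * (1 - t / N) ^+ m -
    N^-1 * (t `^ (a + 1) * (1 - t / N) ^+ m))).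
  by apply: eq_Rintegral => t /E.
rewrite RintegralB// RintegralZl// e1 e2.
have c1 : 0 < rising_coef (a + 1) m by rewrite rising_coef_gt0//; lra.
have m0 : 0 <= m%:R :> R by [].
rewrite (_ : rising_coef (a + 1 + 1) m =
    rising_coef (a + 1) m * (a + 1 + m%:R) / (a + 1)); last first.
  apply: (@mulfI _ (a + 1)); first by rewrite gt_eqF//; lra.
  by rewrite mulr_rising_coef_shift mulr_rising_coefS; field; rewrite gt_eqF//; lra.
have pS b : N `^ (b + 1) = N `^ b * N.
  by rewrite powRD ?(gt_eqF N0) ?implybT// powRr1 ?(ltW N0).
rewrite rising_coefS !pS -natr1.
field; rewrite !gt_eqF//; lra.
Qed.

(** [(a + 1)_N / (N! N ^ a)] for [N = n + 1], the reciprocal of Euler's (or Gauss's)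
    approximation of [Gamma (a + 1)]. The shift keeps [N] positive. *)
Definition gauss_ratio a n : R := rising_coef (a + 1) n.+1 / n.+1%:R `^ a.

Lemma Rintegral_gamma_trunc a n : 0 <= a ->
  Rintegral mu `]0, +oo[ (gamma_trunc a n.+1) =
  n.+1%:R / (a + 1 + n.+1%:R) / gauss_ratio a n.
Proof.
move=> a0; have N0 : 0 < n.+1%:R :> R by [].
rewrite (_ : Rintegral _ _ _ = Rintegral mu `]0, n.+1%:R[
    (fun t => t `^ a * (1 - t / n.+1%:R) ^+ n.+1)).
  rewrite (euler_integral _ a0 N0).2 /gauss_ratio.
  have c1 : 0 < rising_coef (a + 1) n.+1 by rewrite rising_coef_gt0//; lra.
  have p0 : 0 < n.+1%:R `^ a by rewrite powR_gt0.
  rewrite powRD ?(gt_eqF N0) ?implybT// powRr1//.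
  by field; rewrite !gt_eqF//=; lra.
rewrite (_ : `]0, n.+1%:R[%classic = `]0, +oo[ `&` `]0, n.+1%:R[); last first.
  apply/seteqP; split => t /=; rewrite !in_itv /= ?andbT; first by case/andP=> ->.
  by case=> _ /andP[-> ->].
rewrite Rintegral_mkcondr; apply: eq_Rintegral => t /set_mem /=.
rewrite in_itv /= andbT patchE => t0; case: ifPn => [/set_mem|/negP] /=.
  rewrite in_itv /= t0 /= => tn; rewrite /gamma_trunc (_ : Num.max _ _ = 1 - t / n.+1%:R)//.
  by apply/max_idPr; rewrite subr_ge0 ler_pdivrMr// mul1r ltW.
move=> h; have tn : n.+1%:R <= t.
  by rewrite leNgt; apply/negP => tn; apply: h; apply/mem_set; rewrite /= in_itv /= t0 tn.
rewrite /gamma_trunc (_ : Num.max 0 _ = 0) ?expr0n ?mulr0//.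
by apply/max_idPl; rewrite subr_le0 ler_pdivlMr// mul1r.
Qed.

Lemma gauss_ratio_gt0 a n : 0 <= a -> 0 < gauss_ratio a n.
Proof.
by move=> a0; rewrite divr_gt0 ?powR_gt0// rising_coef_gt0//; lra.
Qed.

Lemma Gamma_gt0 a : 0 <= a -> 0 < Gamma (a + 1).
Proof.
move=> a0; apply: (@lt_le_trans _ _ (Rintegral mu `]0, +oo[ (gamma_trunc a 1))).
  rewrite (Rintegral_gamma_trunc 0 a0) divr_gt0 ?gauss_ratio_gt0//.
  by rewrite divr_gt0// addr_gt0//; lra.
have ig := integrable_powR_expRN a0.
rewrite /Gamma addrK; apply: le_Rintegral => //.
  apply: le_integrable ig => //.
    apply/measurable_EFinP; apply: measurable_funTS; exact: measurable_gamma_trunc.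
  move=> t; rewrite /= in_itv /= andbT => t0.
  rewrite lee_fin !ger0_norm ?gamma_trunc_ge0 ?gamma_trunc_le//.
  by rewrite mulr_ge0 ?powR_ge0 ?expR_ge0.
by move=> t; rewrite /= in_itv /= andbT => t0; exact: gamma_trunc_le.
Qed.

(** Up to the factor [(1 + (a + 1) / N) ^ (-1)], the ratio is the reciprocal of the
    truncated Gamma integral. *)
Lemma gauss_ratio_cvg a : 0 <= a ->
  gauss_ratio a @ \oo --> (Gamma (a + 1))^-1.
Proof.
move=> a0; have G0 := Gamma_gt0 a0.
have E n : gauss_ratio a n =
  (1 + (a + 1) / n.+1%:R)^-1 * (Rintegral mu `]0, +oo[ (gamma_trunc a n.+1))^-1.
  rewrite Rintegral_gamma_trunc//; have g0 := gauss_ratio_gt0 n a0.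
  have n0 : 0 < n%:R + 1 :> R by rewrite natr1.
  by rewrite -natr1; field; rewrite !gt_eqF//; lra.
rewrite (funext E) -[X in _ --> X]mul1r; apply: cvgM; last first.
  by apply: cvgV; [rewrite gt_eqF|exact: Rintegral_gamma_trunc_cvg].
rewrite -[X in _ --> X]invr1; apply: cvgV; first by rewrite oner_eq0.
rewrite -[X in _ --> X]addr0; apply: cvgD; first exact: cvg_cst.
rewrite -[X in _ --> X](mulr0 (a + 1)); apply: cvgMr; exact: cvg_harmonic.
Qed.

(** The claim is [1 + a / (N + 1) <= (1 + 1 / N) ^ a]. It holds because
    [exp (1 / (N + 1)) <= 1 + 1 / N] and [1 + y <= exp y]. *)
Lemma gauss_ratio_nonincreasing a n : 0 <= a -> gauss_ratio a n.+1 <= gauss_ratio a n.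
Proof.
move=> a0; have c1 : 0 < rising_coef (a + 1) n.+1 by rewrite rising_coef_gt0//; lra.
rewrite /gauss_ratio rising_coefS -mulrA ler_wpM2l ?(ltW c1)//.
rewrite ler_pdivrMr ?powR_gt0// mulrC.
have n1 : 0 < n%:R + 1 :> R by rewrite natr1.
have -> : (n.+2%:R : R) `^ a = n.+1%:R `^ a * (1 + n.+1%:R^-1) `^ a.
  rewrite -powRM//; congr (_ `^ _); rewrite -!natr1; field.
  by rewrite gt_eqF.
rewrite mulrA mulVf ?mul1r; last by rewrite gt_eqF// powR_gt0.
apply: (@le_trans _ _ (expR (n.+2%:R^-1) `^ a)).
  rewrite -expRM; apply: le_trans (expR_ge1Dx _).
  rewrite le_eqVlt; apply/orP; left; apply/eqP; rewrite -!natr1; field.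
  by rewrite gt_eqF//; lra.
apply: ge0_ler_powR; rewrite ?nnegrE ?expR_ge0 ?addr_ge0//.
rewrite -[leLHS]invrK -expRN; apply: (@le_trans _ _ (1 - n.+2%:R^-1)^-1).
  by rewrite lef_pV2 ?posrE ?expR_gt0 ?expR_ge1Dx// subr_gt0 invf_lt1// ltr1n.
rewrite le_eqVlt; apply/orP; left; apply/eqP; rewrite -!natr1; field.
by rewrite !gt_eqF//; lra.
Qed.

Lemma gauss_ratio_le a m n : 0 <= a -> (m <= n)%N -> gauss_ratio a n <= gauss_ratio a m.
Proof.
move=> a0; elim: n => [|n IHn]; first by rewrite leqn0 => /eqP ->.
rewrite leq_eqVlt => /predU1P[->//|]; rewrite ltnS => /IHn.
by apply: le_trans; exact: gauss_ratio_nonincreasing.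
Qed.

End GammaLimit.

(** * The Mittag-Leffler function on the left half-plane *)

Section DiscreteMittagLeffler.
Variable R : realType.
Variable lam : R.
Hypotheses (lam0 : 0 < lam) (lam1 : lam <= 1).
Implicit Types (w z : R[i]).

(** The solution after [n] steps of the discretised equation
    [D ^ lam u = - z u], [u 0 = 1], with [w = z h ^ lam] for the step [h]; the
    series that defines it is cut after the power [K]. *)
Definition discrete_ml n K w : R[i] :=
  \sum_(k < K.+1) (- w) ^+ k * (rising_coef (lam * k%:R + 1) n)%:C.

(** The scheme itself: the coefficients of [- lam] are the Gruenwald-Letnikov
    weights of the fractional derivative. By Chu-Vandermonde, their convolution
    with [discrete_ml] lowers every argument [lam * k + 1] by [lam], which shifts
    the series by one power of [w]. The last term is due to the cut at [K]. *)
Lemma discrete_ml_recurrence n K w :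
  (1 + w) * discrete_ml n K w =
  (rising_coef (1 - lam) n)%:C +
  \sum_(j < n) (- rising_coef (- lam) j.+1)%:C * discrete_ml (n - j.+1) K w -
  (- w) ^+ K.+1 * (rising_coef (lam * K%:R + 1) n)%:C.
Proof.
have conv : \sum_(j < n.+1) (rising_coef (- lam) j)%:C * discrete_ml (n - j) K w =
    (rising_coef (1 - lam) n)%:C - w * (discrete_ml n K w -
      (- w) ^+ K * (rising_coef (lam * K%:R + 1) n)%:C).
  transitivity (\sum_(k < K.+1) (- w) ^+ k *
      (rising_coef (lam * k%:R + 1 - lam) n)%:C).
    rewrite /discrete_ml; under eq_bigr do rewrite mulr_sumr.
    rewrite exchange_big /=; apply: eq_bigr => k _.
    rewrite [_ - lam]addrC -rising_coef_convolution rmorph_sum mulr_sumr.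
    by apply: eq_bigr => j _; rewrite rmorphM mulrCA.
  rewrite big_ord_recl /= expr0 mul1r mulr0 add0r; congr (_ + _).
  rewrite /discrete_ml big_ord_recr /= addrK mulr_sumr -sumrN.
  apply: eq_bigr => k _; rewrite exprS !mulNr -mulrA; congr (- (_ * (_ * _%:C))).
  by congr rising_coef; rewrite /bump /= add1n -natr1; ring.
move: conv; rewrite big_ord_recl /= rising_coef0 mul1r subn0.
under eq_bigr do rewrite /bump /= add1n.
move=> conv; under eq_bigr do rewrite rmorphN mulNr.
rewrite sumrN mulrDl mul1r -[X in X + _](addrK
  (\sum_(i < n) (rising_coef (- lam) i.+1)%:C * discrete_ml (n - i.+1) K w)).
by rewrite conv exprS; ring.
Qed.

(** The first factor is [- lam] and the other ones are nonnegative: here [lam <= 1]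
    is essential. *)
Lemma rising_coef_opp_le0 n : rising_coef (- lam) n.+1 <= 0.
Proof.
rewrite /rising_coef big_ord_recl addr0 divr1 mulNr oppr_le0.
apply: mulr_ge0; first exact: ltW.
apply: prodr_ge0 => k _; rewrite divr_ge0// lift0 addrC subr_ge0.
by apply: le_trans lam1 _; rewrite ler1n.
Qed.

Lemma sum_rising_coef_opp n :
  rising_coef (1 - lam) n + \sum_(j < n) (- rising_coef (- lam) j.+1) = 1.
Proof.
rewrite [1 - lam]addrC -sum_rising_coef big_ord_recl rising_coef0 -addrA.
rewrite sumrN; under eq_bigr do rewrite lift0.
by rewrite subrr addr0.
Qed.

(** Discrete maximum principle: the right-hand side of the recurrence is an average
    of [1] and of earlier values, by [sum_rising_coef_opp], and
    [|1 + w| >= 1]. The errors of the cut accumulate over the steps. *)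
Lemma normc_discrete_ml_le n K w : 0 <= complex.Re w ->
  normc (discrete_ml n K w) <= 1 +
    \sum_(m < n.+1) normc w ^+ K.+1 * rising_coef (lam * K%:R + 1) m.
Proof.
move=> w0; pose e m := normc w ^+ K.+1 * rising_coef (lam * K%:R + 1) m.
have e0 m : 0 <= e m.
  by rewrite mulr_ge0 ?exprn_ge0 ?normc_ge0// rising_coef_ge0// addr_ge0// mulr_ge0// ltW.
have w1 : 1 <= normc (1 + w).
  apply: le_trans (ler_Re_normc _); rewrite ReD /= ger0_norm ?addr_ge0//.
  by rewrite lerDl.
elim/ltn_ind: n => n IHn.
pose E := \sum_(m < n) e m.
have E0 : 0 <= E by exact: sumr_ge0.
have IHE j : (j < n)%N -> normc (discrete_ml (n - j.+1) K w) <= 1 + E.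
  move=> jn; have nj : (n - j.+1 < n)%N by rewrite ltn_subrL (leq_ltn_trans _ jn).
  apply: le_trans (IHn _ nj) _.
  rewrite lerD2l /E -!(big_mkord predT e) [leRHS](@big_cat_nat _ _ _ (n - j.+1).+1) //=.
  by rewrite lerDl sumr_ge0.
have c0 : 0 <= rising_coef (1 - lam) n by rewrite rising_coef_ge0// subr_ge0.
apply: (@le_trans _ _ (normc ((1 + w) * discrete_ml n K w))).
  by rewrite ComplexField.Normc.normcM ler_peMl ?normc_ge0.
rewrite discrete_ml_recurrence; apply: le_trans (le_normcD _ _) _.
rewrite big_ord_recr /= addrA normcN ComplexField.Normc.normcM normcX normcN.
rewrite normc_real ger0_norm; last first.
  by rewrite rising_coef_ge0// addr_ge0// mulr_ge0// ltW.
rewrite lerD2r; apply: le_trans (le_normcD _ _) _.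
rewrite normc_real (ger0_norm c0).
apply: (@le_trans _ _ (rising_coef (1 - lam) n +
   \sum_(j < n) (- rising_coef (- lam) j.+1) * (1 + E))).
  rewrite lerD2l; apply: le_trans (ler_normc_sum _ _ _) _; apply: ler_sum => j _.
  have c1 : 0 <= - rising_coef (- lam) j.+1 by rewrite oppr_ge0 rising_coef_opp_le0.
  by rewrite ComplexField.Normc.normcM normc_real (ger0_norm c1) ler_wpM2l// IHE.
rewrite -mulr_suml; have := sum_rising_coef_opp n.
move: (\sum_(j < n) _) => s hs; have -> : s = 1 - rising_coef (1 - lam) n by lra.
rewrite -[X in _ <= 1 + X]/E; nra.
Qed.

Definition ml_coef k : R := (Gamma (lam * k%:R + 1))^-1.

Let lamk_ge0 k : 0 <= lam * k%:R.
Proof. by rewrite mulr_ge0// ltW. Qed.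

Lemma ml_coef_ge0 k : 0 <= ml_coef k.
Proof. by rewrite invr_ge0 ltW// Gamma_gt0. Qed.

Lemma ml_coef_le n k : ml_coef k <= gauss_ratio (lam * k%:R) n.
Proof.
have h := gauss_ratio_cvg (lamk_ge0 k).
rewrite /ml_coef -(cvg_lim (@Rhausdorff R) h).
apply: nonincreasing_cvgn_ge (cvgP _ h) n => i j ij.
exact: gauss_ratio_le.
Qed.

Lemma gauss_ratio_powR (x : R) n k : x ^+ k * gauss_ratio (lam * k%:R) n =
  (x / n.+1%:R `^ lam) ^+ k * rising_coef (lam * k%:R + 1) n.+1.
Proof.
rewrite /gauss_ratio powRrM powR_mulrn ?powR_ge0// exprMn exprVn.
by rewrite -mulrA; congr (_ * _); rewrite mulrC.
Qed.

Lemma discrete_ml_gauss n K z : discrete_ml n.+1 K (z / (n.+1%:R `^ lam)%:C) =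
  \sum_(k < K.+1) (- z) ^+ k * (gauss_ratio (lam * k%:R) n)%:C.
Proof.
apply: eq_bigr => k _.
rewrite /gauss_ratio powRrM powR_mulrn ?powR_ge0// fmorph_div rmorphXn.
by rewrite -mulNr exprMn exprVn -!mulrA; congr (_ * _); rewrite mulrC.
Qed.

(** Fixes the step from which [|w| = |z| / n ^ lam] is smaller than [1], so that the
    series of [discrete_ml] converges. *)
Lemma dominating_scale (x : R) : 0 <= x ->
  exists2 N : nat, 0 <= x / N.+1%:R `^ lam & forall n, (N <= n)%N ->
    x / n.+1%:R `^ lam <= x / N.+1%:R `^ lam < 1.
Proof.
move=> x0; (* [n >= y] forces [n ^ lam >= x + 1 > x]. *)
pose y := (x + 1) `^ lam^-1.
have y0 : 0 < y by rewrite powR_gt0//; lra.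
exists (Num.truncn y); first by rewrite divr_ge0 ?powR_ge0.
move=> n hn; apply/andP; split.
  rewrite ler_wpM2l// lef_pV2 ?posrE ?powR_gt0//.
  by apply: ge0_ler_powR; rewrite ?nnegrE ?(ltW lam0)// ler_nat.
rewrite ltr_pdivrMr ?powR_gt0// mul1r.
apply: (@lt_le_trans _ _ (x + 1)); first lra.
have -> : x + 1 = y `^ lam.
  by rewrite -powRrM mulVf ?gt_eqF// powRr1//; lra.
apply: ge0_ler_powR; rewrite ?nnegrE ?(ltW lam0) ?(ltW y0)//.
by rewrite ltW// truncnS_gt.
Qed.

(** With [x = |z|], the moduli of the terms at step [N]; by monotonicity they bound
    those of all later steps and those of the Mittag-Leffler series. *)
Definition ml_majorant (x : R) N k : R := x ^+ k * gauss_ratio (lam * k%:R) N.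

Lemma ml_majorant_ge0 (x : R) N k : 0 <= x -> 0 <= ml_majorant x N k.
Proof. by move=> x0; rewrite mulr_ge0 ?exprn_ge0// ltW// gauss_ratio_gt0. Qed.

(** For [lam <= 1] the terms are at most [(k + 1)_(N + 1) / (N + 1)! * r ^ k], which is
    the [k]-th term of the binomial series of [(1 - r) ^ (- N - 2)]. *)
Lemma ml_majorant_cvg (x : R) N : 0 <= x -> x / N.+1%:R `^ lam < 1 ->
  cvgn (series (ml_majorant x N)).
Proof.
move=> x0; set r := x / _ => r1; have r0 : 0 <= r by rewrite divr_ge0 ?powR_ge0.
apply: nondecreasing_is_cvgn.
  apply/nondecreasing_seqP => n; rewrite /series /= big_nat_recr//= lerDl.
  exact: ml_majorant_ge0.
exists ((1 - r) ^- N.+2) => _ [n _ <-]; rewrite /series /= big_mkord.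
apply: le_trans (@binomial_sum_nat_le R N.+2 n r r0 r1).
rewrite /binomial_sum big_ord_recr /=; apply: ler_wpDr.
  by rewrite mulr_ge0 ?exprn_ge0// rising_coef_ge0.
apply: ler_sum => k _; rewrite /ml_majorant gauss_ratio_powR mulrC ler_wpM2r ?exprn_ge0//.
rewrite -rising_coef_nat -[k.+1%:R]natr1 ler_rising_coef ?addr_ge0//.
by rewrite lerD2r ler_piMl.
Qed.

Lemma normc_sum_ml_le z (P : nat -> R) (Q : nat -> R) m n :
  (forall k, 0 <= P k <= Q k) ->
  normc (\sum_(m <= k < n) (- z) ^+ k * (P k)%:C) <=
  \sum_(m <= k < n) normc z ^+ k * Q k.
Proof.
move=> PQ; apply: le_trans (ler_normc_sum _ _ _) _; apply: ler_sum => k _.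
have /andP[P0 PQk] := PQ k.
rewrite ComplexField.Normc.normcM normcX normcN normc_real ger0_norm//.
by rewrite ler_wpM2l ?exprn_ge0 ?normc_ge0.
Qed.

Lemma mittag_leffler_sum z n :
  series (fun k => z ^+ k / (Gamma (lam * k%:R + 1))%:C) n =
  \sum_(0 <= k < n) (- - z) ^+ k * (ml_coef k)%:C.
Proof. by apply: eq_bigr => k _; rewrite opprK /ml_coef fmorphV. Qed.

Lemma mittag_leffler_cvg z :
  (fun n => complex.Re (\sum_(0 <= k < n) (- z) ^+ k * (ml_coef k)%:C)) @ \oo
    --> complex.Re (mittag_leffler lam (- z)) /\
  (fun n => complex.Im (\sum_(0 <= k < n) (- z) ^+ k * (ml_coef k)%:C)) @ \oo
    --> complex.Im (mittag_leffler lam (- z)).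
Proof.
have [N r0 hN] := dominating_scale (normc_ge0 z).
have /andP[_ r1] := hN N (leqnn N).
have M := ml_majorant_cvg (normc_ge0 z) r1.
have part (p : R[i] -> R) : (forall x y, p (x + y) = p x + p y) -> p 0 = 0 ->
    (forall x, `|p x| <= normc x) ->
    cvgn (fun n => p (\sum_(0 <= k < n) (- z) ^+ k * (ml_coef k)%:C)).
  move=> pD p0 pn.
  have -> : (fun n => p (\sum_(0 <= k < n) (- z) ^+ k * (ml_coef k)%:C)) =
      series (fun k => p ((- z) ^+ k * (ml_coef k)%:C)).
    by apply/funext => n; rewrite /series /= (big_morph p pD p0).
  apply: normed_cvg; apply: series_le_cvg M => k //=.
    by rewrite ml_majorant_ge0// normc_ge0.
  apply: le_trans (pn _) _.
  rewrite ComplexField.Normc.normcM normcX normcN normc_real ger0_norm ?ml_coef_ge0//.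
  by rewrite ler_wpM2l ?exprn_ge0 ?normc_ge0// ml_coef_le.
have /cvg_ex[a ha] := part _ (@ReD R) erefl (@ler_Re_normc R).
have /cvg_ex[b hb] := part _ (@ImD R) erefl (@ler_Im_normc R).
suff -> : mittag_leffler lam (- z) = a +i* b.
  by [].
rewrite /mittag_leffler (_ : series _ = (fun n =>
    \sum_(0 <= k < n) (- z) ^+ k * (ml_coef k)%:C)); first exact: limn_complex.
by apply/funext => n; rewrite mittag_leffler_sum opprK.
Qed.

(** [K] is kept, and the sum is compared with its extension up to some [K' >= K].
    The extension is bounded by [1] plus the error of the cut at [K'], which
    vanishes as [K'] grows, and the difference by the tail of the majorant. *)
Lemma discrete_ml_gauss_le z N n K (M := ml_majorant (normc z) N) :
  0 <= complex.Re z -> normc z / N.+1%:R `^ lam < 1 -> (N <= n)%N ->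
  normc z / n.+1%:R `^ lam <= normc z / N.+1%:R `^ lam ->
  normc (\sum_(0 <= k < K.+1) (- z) ^+ k * (gauss_ratio (lam * k%:R) n)%:C) <=
  1 + (limn (series M) - series M K.+1).
Proof.
move=> z0; set r := normc z / _ => r1 Nn rn; set S := limn _.
have rn0 : 0 <= normc z / n.+1%:R `^ lam by rewrite divr_ge0 ?normc_ge0 ?powR_ge0.
have r0 : 0 <= r by exact: le_trans rn.
have M0 k : 0 <= M k by rewrite ml_majorant_ge0 ?normc_ge0.
have Mc : cvgn (series M) by exact: ml_majorant_cvg (normc_ge0 z) r1.
(* Bounds the error of [normc_discrete_ml_le] after the use of [lam <= 1] and
   [rising_coef_nat]. *)
pose err K' := \sum_(m < n.+2) r * (rising_coef m.+1%:R K' * r ^+ K').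
have err0 : err @ \oo --> 0.
  suff : err @ \oo --> \sum_(m < n.+2) (0 : R) by rewrite big1.
  apply: cvg_big => [|m _]; first exact: add_continuous.
  rewrite -[X in _ --> X](mulr0 r); apply: cvgMr; exact: rising_coef_geometric_cvg0.
have bnd K' : (K <= K')%N ->
  normc (\sum_(0 <= k < K.+1) (- z) ^+ k * (gauss_ratio (lam * k%:R) n)%:C) <=
  1 + (S - series M K.+1) + err K'.
  move=> KK'.
  have split_sum : \sum_(0 <= k < K.+1) (- z) ^+ k * (gauss_ratio (lam * k%:R) n)%:C =
    discrete_ml n.+1 K' (z / (n.+1%:R `^ lam)%:C) -
    \sum_(K.+1 <= k < K'.+1) (- z) ^+ k * (gauss_ratio (lam * k%:R) n)%:C.
    rewrite discrete_ml_gauss -(big_mkord predT (fun k =>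
      (- z) ^+ k * (gauss_ratio (lam * k%:R) n)%:C)).
    by rewrite [X in _ = X - _](@big_cat_nat _ _ _ K.+1)//= addrK.
  rewrite split_sum; apply: le_trans (le_normcD _ _) _; rewrite normcN.
  rewrite -addrA [_ + err K']addrC addrA; apply: lerD.
    apply: le_trans (normc_discrete_ml_le _ _ _) _.
      rewrite -fmorphV ReM /= mulr0 subr0 mulr_ge0// invr_ge0 powR_ge0//.
    rewrite lerD2l; apply: ler_sum => m _.
    have -> : normc (z / (n.+1%:R `^ lam)%:C) = normc z / n.+1%:R `^ lam.
      by rewrite ComplexField.Normc.normcM ComplexField.Normc.normcV normc_real ger0_norm ?powR_ge0.
    rewrite exprS -mulrA; apply: ler_pM => //.
      by rewrite mulr_ge0 ?exprn_ge0// rising_coef_ge0// addr_ge0.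
    rewrite mulrC; apply: ler_pM; rewrite ?exprn_ge0//.
    + by rewrite rising_coef_ge0// addr_ge0.
    + by rewrite -rising_coef_nat -[K'.+1%:R]natr1 ler_rising_coef ?addr_ge0// lerD2r ler_piMl.
    + by rewrite lerXn2r// nnegrE.
  apply: le_trans (@normc_sum_ml_le z _ (fun k => gauss_ratio (lam * k%:R) N) _ _ _) _.
    by move=> k; rewrite ltW ?gauss_ratio_gt0//= gauss_ratio_le.
  have -> : \sum_(K.+1 <= k < K'.+1) normc z ^+ k * gauss_ratio (lam * k%:R) N =
      series M K'.+1 - series M K.+1.
    by rewrite /series /= [\sum_(0 <= k < K'.+1) _](@big_cat_nat _ _ _ K.+1)//= addrAC subrr add0r.
  rewrite lerD2r; apply: nondecreasing_cvgn_le Mc _.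
  by apply/nondecreasing_seqP => i; rewrite /series /= big_nat_recr//= lerDl.
rewrite -[leRHS]addr0; apply: (ler_cvg_to (cvg_cst _)
  (cvgD (cvg_cst (1 + (S - series M K.+1))) err0)).
by exists K => // K' /= /bnd.
Qed.

(** The number of steps tends to infinity first, for a fixed number of terms, and
    the number of terms next. *)
Lemma normc_mittag_leffler_le1 z : 0 <= complex.Re z ->
  normc (mittag_leffler lam (- z)) <= 1.
Proof.
move=> z0; have [N r0 hN] := dominating_scale (normc_ge0 z).
have /andP[_ r1] := hN N (leqnn N).
have Mc := ml_majorant_cvg (normc_ge0 z) r1.
set M := ml_majorant (normc z) N in Mc.
have bnd K : normc (\sum_(0 <= k < K.+1) (- z) ^+ k * (ml_coef k)%:C) <=
    1 + (limn (series M) - series M K.+1).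
  have part (p : R[i] -> R) : (forall x y, p (x + y) = p x + p y) -> p 0 = 0 ->
      (forall x y, p (x * y%:C) = p x * y) ->
      (fun n => p (\sum_(0 <= k < K.+1) (- z) ^+ k * (gauss_ratio (lam * k%:R) n)%:C))
      @ \oo --> p (\sum_(0 <= k < K.+1) (- z) ^+ k * (ml_coef k)%:C).
    move=> pD p0 pZ; rewrite (big_morph p pD p0).
    under eq_fun do rewrite (big_morph p pD p0).
    apply: cvg_big => [|k _]; first exact: add_continuous.
    rewrite pZ; under eq_fun do rewrite pZ.
    by apply: cvgMr; exact: gauss_ratio_cvg.
  have hr := part _ (@ReD R) erefl (fun x y => _).
  have hi := part _ (@ImD R) erefl (fun x y => _).
  apply: (ler_cvg_to (cvg_normc (hr _) (hi _)) (cvg_cst _)).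
  - by move=> x y; rewrite ReM /= mulr0 subr0.
  - by move=> x y; rewrite ImM /= mulr0 add0r.
  - exists N => // n /= Nn; apply: discrete_ml_gauss_le => //.
    by have /andP[] := hN n Nn.
have [hr hi] := mittag_leffler_cvg z.
have hc := cvg_normc hr hi; rewrite -(cvg_shiftS) in hc.
have hM : (fun K => 1 + (limn (series M) - series M K.+1)) @ \oo --> 1 + (0 : R).
  apply: cvgD; first exact: cvg_cst.
  rewrite -(subrr (limn (series M))); apply: cvgB; first exact: cvg_cst.
  by rewrite (cvg_shiftS (series M)).
rewrite -[leRHS]addr0; apply: ler_cvg_to hc hM _.
exact: nearW.
Qed.

End DiscreteMittagLeffler.

(** * Complex-valued integrals *)

Section ComplexMeasurable.
Variable R : realType.
Variable D : set (measurableTypeR R).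
Implicit Types f g : R -> R[i].

(** The domain is [measurableTypeR R], which carries the sigma-algebra of
    [lebesgue_measure]. *)
Definition cmeasurable f : Prop :=
  measurable_fun D (fun t : measurableTypeR R => complex.Re (f t)) /\
  measurable_fun D (fun t : measurableTypeR R => complex.Im (f t)).

Lemma cmeasurable_cst (c : R[i]) : cmeasurable (fun=> c).
Proof. by split; exact: measurable_cst. Qed.

Lemma cmeasurable_real (h : measurableTypeR R -> R) : measurable_fun D h ->
  cmeasurable (fun t => (h t)%:C).
Proof. by split => //=; exact: measurable_cst. Qed.

Lemma cmeasurableM f g : cmeasurable f -> cmeasurable g ->
  cmeasurable (fun t => f t * g t).
Proof.
move=> [f1 f2] [g1 g2]; split.
  under eq_fun do rewrite ReM.
  by apply: measurable_funB; apply: measurable_funM.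
under eq_fun do rewrite ImM.
by apply: measurable_funD; apply: measurable_funM.
Qed.

Lemma cmeasurableD f g : cmeasurable f -> cmeasurable g ->
  cmeasurable (fun t => f t + g t).
Proof.
move=> [f1 f2] [g1 g2]; split.
  by under eq_fun do rewrite ReD; apply: measurable_funD.
by under eq_fun do rewrite ImD; apply: measurable_funD.
Qed.

Lemma cmeasurableX f n : cmeasurable f -> cmeasurable (fun t => f t ^+ n).
Proof.
move=> mf; elim: n => [|n IHn].
  by under eq_fun do rewrite expr0; exact: cmeasurable_cst.
by under eq_fun do rewrite exprS; exact: cmeasurableM.
Qed.

Lemma cmeasurable_cpowR (h : measurableTypeR R -> R) (z : R[i]) :
  measurable_fun D h ->
  cmeasurable (fun t => cpowR (h t) z).
Proof.
move=> mh; apply: cmeasurableM.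
  by apply: cmeasurable_real; exact: (measurableT_comp (measurable_powR _) mh).
have ml : measurable_fun D (fun t : measurableTypeR R => complex.Im z * ln (h t)).
  apply: measurable_funM; first exact: measurable_cst.
  exact: (measurableT_comp (@measurable_ln R) mh).
split => /=.
  apply: (measurableT_comp _ ml); apply: continuous_measurable_fun.
  exact: continuous_cos.
apply: (measurableT_comp _ ml); apply: continuous_measurable_fun.
exact: continuous_sin.
Qed.

(** A pointwise limit of the partial sums of the series. *)
Lemma cmeasurable_mittag_leffler (lam : R) f : measurable D ->
  0 < lam -> lam <= 1 -> cmeasurable f ->
  cmeasurable (fun t => mittag_leffler lam (- f t)).
Proof.
move=> mD lam0 lam1 mf.
have ms n : cmeasurable (fun t =>
    \sum_(0 <= k < n) (- f t) ^+ k * (ml_coef lam k)%:C).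
  elim: n => [|n IHn].
    by under eq_fun do rewrite big_geq//; exact: cmeasurable_cst.
  under eq_fun do rewrite big_nat_recr//=.
  apply: cmeasurableD => //; apply: cmeasurableM; last exact: cmeasurable_cst.
  apply: cmeasurableX; under eq_fun do rewrite -mulN1r.
  by apply: cmeasurableM => //; exact: cmeasurable_cst.
split.
  apply: (measurable_fun_cvg (fun n => (ms n).1)) => t _.
  by have [] := mittag_leffler_cvg lam0 lam1 (f t).
apply: (measurable_fun_cvg (fun n => (ms n).2)) => t _.
by have [] := mittag_leffler_cvg lam0 lam1 (f t).
Qed.

End ComplexMeasurable.

Section ComplexIntegral.
Variable R : realType.
Notation mu := (@lebesgue_measure R).
Variables (D : set (measurableTypeR R)) (mD : measurable D).
Implicit Types f g : R -> R[i].

Lemma cintegrable_dominated f (g : R -> R) : cmeasurable D f ->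
  (forall t, D t -> normc (f t) <= g t) ->
  mu.-integrable D (EFin \o g) -> cintegrable D f.
Proof.
move=> [f1 f2] fg ig; split.
  apply: (integrable_EFin_le mD f1 _ ig) => t Dt.
  by apply: le_trans (ler_Re_normc _) (fg t Dt).
apply: (integrable_EFin_le mD f2 _ ig) => t Dt.
by apply: le_trans (ler_Im_normc _) (fg t Dt).
Qed.

Lemma cintegrable_measurable f : cintegrable D f -> cmeasurable D f.
Proof.
by move=> [/measurable_int/measurable_EFinP f1 /measurable_int/measurable_EFinP].
Qed.

Lemma cintegrable_normc f : cintegrable D f ->
  mu.-integrable D (EFin \o (fun t => `|complex.Re (f t)| + `|complex.Im (f t)|)).
Proof.
by move=> [f1 f2]; apply: integrable_addr => //; exact: integrable_norm.
Qed.

Lemma cintegrableZ c f : cintegrable D f -> cintegrable D (fun t => c * f t).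
Proof.
move=> [f1 f2]; split.
  under eq_fun do rewrite ReM.
  exact: (integrable_subr mD (integrable_mull mD _ f1) (integrable_mull mD _ f2)).
under eq_fun do rewrite ImM.
exact: (integrable_addr mD (integrable_mull mD _ f2) (integrable_mull mD _ f1)).
Qed.

Lemma cintegrableD f g : cintegrable D f -> cintegrable D g ->
  cintegrable D (fun t => f t + g t).
Proof.
move=> [f1 f2] [g1 g2]; split.
  by under eq_fun do rewrite ReD; exact: (integrable_addr mD f1 g1).
by under eq_fun do rewrite ImD; exact: (integrable_addr mD f2 g2).
Qed.

Lemma cintegralZ c f : cintegrable D f ->
  cintegral D (fun t => c * f t) = c * cintegral D f.
Proof.
move=> [f1 f2]; apply/eqP; rewrite eq_complex ReM ImM /=; apply/andP; split; apply/eqP.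
  under eq_Rintegral do rewrite ReM.
  by rewrite RintegralB// ?RintegralZl//; exact: integrable_mull.
under eq_Rintegral do rewrite ImM.
by rewrite RintegralD// ?RintegralZl//; exact: integrable_mull.
Qed.

Lemma cintegralD f g : cintegrable D f -> cintegrable D g ->
  cintegral D (fun t => f t + g t) = cintegral D f + cintegral D g.
Proof.
move=> [f1 f2] [g1 g2]; apply/eqP; rewrite eq_complex ReD ImD /=.
apply/andP; split; apply/eqP.
  by under eq_Rintegral do rewrite ReD; rewrite RintegralD.
by under eq_Rintegral do rewrite ImD; rewrite RintegralD.
Qed.

Lemma cintegral_sum (f_ : nat -> R -> R[i]) n :
  (forall k, cintegrable D (f_ k)) ->
  cintegrable D (fun t => \sum_(k < n.+1) f_ k t) /\
  cintegral D (fun t => \sum_(k < n.+1) f_ k t) = \sum_(k < n.+1) cintegral D (f_ k).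
Proof.
move=> hf; elim: n => [|n [i1 e1]].
  rewrite big_ord_recr big_ord0 /= add0r.
  by under eq_fun do rewrite big_ord_recr big_ord0 /= add0r.
under eq_fun do rewrite big_ord_recr /=.
by rewrite cintegralD// e1 [RHS]big_ord_recr; split => //; exact: cintegrableD.
Qed.

Lemma cintegral_dominated_cvg (f_ : nat -> R -> R[i]) f (g : R -> R) :
  (forall n, cmeasurable D (f_ n)) ->
  (forall t, D t -> (fun n => normc (f t - f_ n t)) @ \oo --> 0) ->
  (forall n t, D t -> normc (f_ n t) <= g t) ->
  mu.-integrable D (EFin \o g) ->
  (fun n => cintegral D (f_ n) : R[i]^o) @ \oo --> (cintegral D f : R[i]^o).
Proof.
move=> mf cf fg ig; apply: cvg_complex => /=.
  apply: (Rintegral_dominated_cvg mD (fun n => (mf n).1) _ ig _).2.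
    by move=> t /cf /normc_cvg0_ReIm[].
  by move=> n t Dt; apply: le_trans (ler_Re_normc _) (fg n t Dt).
apply: (Rintegral_dominated_cvg mD (fun n => (mf n).2) _ ig _).2.
  by move=> t /cf /normc_cvg0_ReIm[].
by move=> n t Dt; apply: le_trans (ler_Im_normc _) (fg n t Dt).
Qed.

End ComplexIntegral.

(** * The extended beta function *)

Section ExtendedBeta.
Variable R : realType.
Notation mu := (@lebesgue_measure R).
Implicit Types (lam sig tau : R) (p q x y : R[i]).

(** As [t + (1 - t) = 1], the function is
    [t ^ (a - 1) * (1 - t) ^ b + t ^ a * (1 - t) ^ (b - 1)], hence at most
    [t ^ (a - 1) + (1 - t) ^ (b - 1)]. *)
Lemma integrable_beta (a b : R) : 0 < a -> 0 < b ->
  mu.-integrable `]0, 1[ (EFin \o (fun t => t `^ (a - 1) * (1 - t) `^ (b - 1))).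
Proof.
move=> a0 b0.
have a1 : -1 < a - 1 by lra.
have b1 : -1 < b - 1 by lra.
have := integrable_addr _ (integrable_powR a1 ltr01) (integrable_onem_powR b1).
move=> /(_ (measurable_itv _)).
apply: integrable_EFin_le => //.
  apply: measurable_funTS; apply: measurable_funM; first exact: measurable_powR.
  by apply: (measurableT_comp (measurable_powR _)); apply: measurable_funB.
move=> t /=; rewrite in_itv /= => /andP[t0 t1].
have t1' : 0 < 1 - t by rewrite subr_gt0.
have powS (s c : R) : 0 < s -> s `^ c = s `^ (c - 1) * s.
  move=> s0; rewrite -[X in _ = _ * X](powRr1 (ltW s0)) -powRD ?subrK//.
  by rewrite (gt_eqF s0) implybT.
have le1 (s c : R) : 0 < s -> s <= 1 -> 0 < c -> s `^ c <= 1.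
  by move=> s0 s1 c0; rewrite -(powRr0 s) ger_powR ?s0 ?(ltW c0).
rewrite ger0_norm ?mulr_ge0 ?powR_ge0//.
rewrite (_ : _ * _ = t `^ (a - 1) * (1 - t) `^ b + t `^ a * (1 - t) `^ (b - 1)); last first.
  by rewrite (powS t a)// (powS (1 - t) b)//; ring.
apply: lerD.
  by rewrite ler_piMr ?powR_ge0// le1//; lra.
by rewrite ler_piMl ?powR_ge0// le1//; lra.
Qed.

(** Both values of the Mittag-Leffler function have modulus at most [1], so that the
    integrand of the ordinary beta function dominates. *)
Lemma extbeta_exists_le1 lam sig tau p q x y : 0 < lam -> lam <= 1 ->
  0 <= complex.Re p -> 0 <= complex.Re q -> 0 < complex.Re x -> 0 < complex.Re y ->
  extbeta_exists lam sig tau p q x y.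
Proof.
move=> lam0 lam1 p0 q0 x0 y0.
have mid : measurable_fun (`]0, 1[%classic : set (measurableTypeR R))
    (fun t : measurableTypeR R => t : R) by exact: measurable_id.
have monem : measurable_fun (`]0, 1[%classic : set (measurableTypeR R))
    (fun t : measurableTypeR R => 1 - (t : R)).
  by apply: measurable_funB => //; exact: measurable_cst.
have mdiv (h : measurableTypeR R -> R) (c : R[i]) (s : R) :
    measurable_fun (`]0, 1[%classic : set (measurableTypeR R)) h ->
    cmeasurable `]0, 1[ (fun t => c / ((h t) `^ s)%:C).
  move=> mh; apply: cmeasurableM; first exact: cmeasurable_cst.
  rewrite (_ : (fun t => _^-1) = (fun t => (h t `^ (- s))%:C)); last first.
    by apply/funext => t; rewrite powRN fmorphV.
  by apply: cmeasurable_real; apply: (measurableT_comp (measurable_powR _)).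
have Rediv (c : R[i]) (u : R) : 0 <= complex.Re c -> 0 <= u ->
    0 <= complex.Re (c / u%:C).
  by move=> c0 u0; rewrite -fmorphV ReM /= mulr0 subr0 mulr_ge0// invr_ge0.
apply: (cintegrable_dominated (measurable_itv _) _ _ (integrable_beta x0 y0)).
  apply: cmeasurableM; first apply: cmeasurableM; first apply: cmeasurableM.
  - exact: cmeasurable_cpowR.
  - exact: cmeasurable_cpowR.
  - by apply: cmeasurable_mittag_leffler => //; exact: mdiv.
  - by apply: cmeasurable_mittag_leffler => //; exact: mdiv.
move=> t /=; rewrite in_itv /= => /andP[t0 t1].
rewrite /extbeta_integrand ComplexField.Normc.normcM.
rewrite -[leRHS]mulr1 ler_pM ?normc_ge0//; last first.
  by apply: normc_mittag_leffler_le1 => //; apply: Rediv => //; exact: powR_ge0.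
rewrite ComplexField.Normc.normcM -[leRHS]mulr1 ler_pM ?normc_ge0//; last first.
  by apply: normc_mittag_leffler_le1 => //; apply: Rediv => //; exact: powR_ge0.
have Re_pred (z : R[i]) : complex.Re (z - 1) = complex.Re z - 1 by case: (z).
by rewrite ComplexField.Normc.normcM !normc_cpowR !Re_pred.
Qed.

Lemma extbeta_integrand_shift lam sig tau p q x y (n : nat) (t : R) : 0 < t < 1 ->
  extbeta_integrand lam sig tau p q (x + n%:R) y t =
  t%:C ^+ n * extbeta_integrand lam sig tau p q x y t.
Proof.
move=> /andP[t0 t1]; rewrite /extbeta_integrand [x + _ - 1]addrAC.
by rewrite (cpowRD (x - 1) n%:R t0) cpowR_nat ?(ltW t0)//; ring.
Qed.

Lemma extbeta_integrand_onem lam sig tau p q x (e : R[i]) (t : R) : 0 < t < 1 ->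
  extbeta_integrand lam sig tau p q x (1 - e) t =
  cpowR (1 - t) (- e) * extbeta_integrand lam sig tau p q x 1 t.
Proof.
move=> /andP[t0 t1]; rewrite /extbeta_integrand addrAC subrr add0r cpowR0; ring.
Qed.

(** The exchange of sum and integral, for all [lam]: it only uses the existence of
    the integrals. The two summands of [binomial_sum_dominated] match the
    integrands at [1] and at [1 - e]. *)
Lemma extbeta_binomial_cvg lam sig tau p q x (e : R[i]) :
  extbeta_exists lam sig tau p q x (1 - e) ->
  (forall n : nat, extbeta_exists lam sig tau p q (x + n%:R) 1) ->
  (series (fun n : nat => rising_coef e n * extbeta lam sig tau p q (x + n%:R) 1)
    : nat -> R[i]^o) @ \oo
    --> (extbeta lam sig tau p q x (1 - e) : R[i]^o).
Proof.
move=> ie in1.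
set f := extbeta_integrand lam sig tau p q x 1.
set F := extbeta_integrand lam sig tau p q x (1 - e).
have if0 : cintegrable `]0, 1[ f by have := in1 0%N; rewrite /extbeta_exists addr0.
have mI : measurable (`]0, 1[%classic : set (measurableTypeR R)) by exact: measurable_itv.
pose fn n (t : R) := \sum_(k < n.+1) rising_coef e k *
  extbeta_integrand lam sig tau p q (x + k%:R) 1 t.
have fnE n (t : R) : 0 < t < 1 -> fn n t = binomial_sum e n t%:C * f t.
  move=> t01; rewrite /fn /binomial_sum mulr_suml; apply: eq_bigr => k _.
  by rewrite extbeta_integrand_shift// mulrA.
have hterm k : cintegrable `]0, 1[ (fun t => rising_coef e k *
    extbeta_integrand lam sig tau p q (x + k%:R) 1 t).
  exact: (cintegrableZ mI (rising_coef e k) (in1 k)).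
have hsum n := cintegral_sum mI n hterm.
rewrite -(cvg_shiftS).
rewrite (_ : (fun n => series _ n.+1) = (fun n => cintegral `]0, 1[ (fn n))); last first.
  apply/funext => n; rewrite (hsum n).2 /series /= big_mkord.
  by apply: eq_bigr => k _; rewrite (cintegralZ mI _ (in1 k)).
have [C hC] := binomial_sum_dominated e.
have C0 : 0 <= C.
  have := hC 0%N 0 (lexx _) ltr01; rewrite subr0 powR1 => h.
  by have := le_trans (normc_ge0 _) h; lra.
pose g t := C * ((`|complex.Re (f t)| + `|complex.Im (f t)|) +
  (`|complex.Re (F t)| + `|complex.Im (F t)|)).
apply: (@cintegral_dominated_cvg R _ mI fn F g).
- by move=> n; apply: cintegrable_measurable => //; exact: (hsum n).1.
- move=> t /=; rewrite in_itv /= => t01; have /andP[t0 t1] := t01.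
  have h := binomial_series_cvg e (ltW t0) t1.
  have E n : normc (F t - fn n t) =
      normc (cpowR (1 - t) (- e) - binomial_sum e n t%:C) * normc (f t).
    by rewrite fnE// /F extbeta_integrand_onem// -mulrBl ComplexField.Normc.normcM.
  by rewrite (funext E) -[X in _ --> X](mul0r (normc (f t))); apply: cvgMl.
- move=> n t /=; rewrite in_itv /= => t01; have /andP[t0 t1] := t01.
  rewrite fnE// ComplexField.Normc.normcM.
  apply: le_trans (ler_wpM2r (normc_ge0 _) (hC n t (ltW t0) t1)) _.
  rewrite -mulrA /g ler_wpM2l// mulrDl mul1r; apply: lerD.
    exact: ler_normc_ReIm.
  apply: le_trans (ler_normc_ReIm _).
  have -> : F t = cpowR (1 - t) (- e) * f t by exact: extbeta_integrand_onem.
  rewrite [leRHS]ComplexField.Normc.normcM normc_cpowR.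
  by have -> : complex.Re (- e) = - complex.Re e by case: (e).
- apply: integrable_mull => //.
  by apply: integrable_addr => //; exact: cintegrable_normc.
Qed.

End ExtendedBeta.

Theorem theorem4 (R : realType) (lam sig tau : R) (p q eta1 eta2 : R[i])
    (hlam : 0 < lam) (hsig : 0 < sig) (htau : 0 < tau)
    (hp : 0 < complex.Re p) (hq : 0 < complex.Re q)
    (heta1 : 0 < complex.Re eta1) (heta2 : 0 < complex.Re (1 - eta2))
    (hexists : 1 < lam ->
       extbeta_exists lam sig tau p q eta1 (1 - eta2) /\
       (forall n : nat, extbeta_exists lam sig tau p q (eta1 + n%:R) 1)) :
  (series (fun n : nat => pochhammer eta2 n / (n`!)%:R *
                          extbeta lam sig tau p q (eta1 + n%:R) 1)
    : nat -> R[i]^o) @ \oo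
    --> (extbeta lam sig tau p q eta1 (1 - eta2) : R[i]^o).
Proof.
under eq_fun do rewrite pochhammer_rising_coef.
have [lam1|/hexists[he hn]] := lerP lam 1; last exact: extbeta_binomial_cvg.
apply: extbeta_binomial_cvg => [|n].
  by apply: extbeta_exists_le1 => //; exact: ltW.
apply: extbeta_exists_le1 => //; rewrite ?ltW//.
by rewrite ReD natr_complex /= ltr_wpDr.
Qed.
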